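(* Let $d\ge1$ and let $\psi:\mathbb N\to\mathbb R^+$ be non-increasing with $\sum_{q=1}^\infty q^{3d}\psi(q)^d<\infty$. Then for every $s\in(0,d)$, $$\mathcal H^s(\mathrm{Exact}(d,\psi))=\begin{cases}0 & \text{if }\sum_{q=1}^\infty q^d\psi(q)^s<\infty,\\ \infty&\text{if }\sum_{q=1}^\infty q^d\psi(q)^s=\infty.\end{cases}$$
   Context: $W(d,\psi)=\{\mathbf x\in[0,1]^d: |\mathbf x-\mathbf p/q|_\infty<\psi(q)\text{ for infinitely many }(\mathbf p,q)\in\mathbb Z^d\times\mathbb N\}$, where $|\mathbf y|_\infty=\max_i|y_i|$. $\mathrm{Exact}(d,\psi)=W(d,\psi)\setminus\bigcup_{0<\epsilon<1}W(d,(1-\epsilon)\psi)$. $\mathcal H^s$ denotes the $s$-dimensional Hausdorff measure (defined with covers by balls and sums of $r_i^s$ of radii). *)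

(* Defs.v *)
From HB Require Import structures.
From mathcomp Require Import all_boot all_order all_algebra.
From mathcomp Require Import all_classical all_reals all_analysis.

Set Implicit Arguments.
Unset Strict Implicit.
Unset Printing Implicit Defensive.

Import Order.TTheory GRing.Theory Num.Theory.
Import numFieldNormedType.Exports.

Local Open Scope classical_set_scope.
Local Open Scope ring_scope.

Section hausdorff_measure.
Context {R : realType} {T : pseudoMetricType R}.

(* The index set [I] makes finite families of balls admissible as well as
   infinite sequences. *)
Definition ball_cover_sums (s delta : R) (A : set T) : set (\bar R) :=
  [set z | exists (I : set nat) (c : nat -> T) (r : nat -> R),
    [/\ forall i, I i -> 0 < r i <= delta,
        A `<=` \bigcup_(i in I) ball (c i) (r i)
      & z = (\esum_(i in I) (r i `^ s)%:E)%E]].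

Definition hausdorff_premeasure (s delta : R) (A : set T) : \bar R :=
  ereal_inf (ball_cover_sums s delta A).

(* The premeasures increase as [delta] decreases, so that this supremum is
   their limit at 0, see [hausdorff_premeasure_cvg]. *)
Definition hausdorff_measure (s : R) (A : set T) : \bar R :=
  ereal_sup [set hausdorff_premeasure s delta A | delta in [set x : R | 0 < x]].

Lemma hausdorff_premeasure_nincr (s d1 d2 : R) (A : set T) : d1 <= d2 ->
  (hausdorff_premeasure s d2 A <= hausdorff_premeasure s d1 A)%E.
Proof.
move=> d12; apply: ereal_inf_le_tmp => _ [I [c [r [rI AI ->]]]].
exists I, c, r; split=> // i /rI /andP[-> rd1] /=.
exact: le_trans rd1 d12.
Qed.

Lemma hausdorff_premeasure_cvg (s : R) (A : set T) :
  hausdorff_premeasure s delta A @[delta --> 0^'+] --> hausdorff_measure s A.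
Proof.
have := @nonincreasing_at_right_cvge R
  (fun delta => hausdorff_premeasure s delta A) 0 (BInfty _ false) isT.
rewrite /hausdorff_measure set_itvoy; apply.
by move=> x y _ _; exact: hausdorff_premeasure_nincr.
Qed.

End hausdorff_measure.

Section exact_approximation.
Context {R : realType}.

(* The norm on ['rV[R]_d] is the maximum norm.  The value [psi 0] is never
   used. *)
Definition approximants (d : nat) (psi : nat -> R) (x : 'rV[R]_d) :
    set ('rV[int]_d * nat) :=
  [set pq | (0 < pq.2)%N /\
    `|x - pq.2%:R^-1 *: map_mx intr pq.1| < psi pq.2].

Definition W (d : nat) (psi : nat -> R) : set 'rV[R]_d :=
  [set x : 'rV[R]_d |
    (forall i, 0 <= x ord0 i <= 1) /\ infinite_set (approximants psi x)].

Arguments W : clear implicits.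

Definition Exact (d : nat) (psi : nat -> R) : set 'rV[R]_d :=
  W d psi `\`
  \bigcup_(e in [set e : R | 0 < e < 1]) W d (fun q => (1 - e) * psi q).

End exact_approximation.

Arguments W {R} d psi.
Arguments Exact {R} d psi.

(* Main.v *)
(* Convergence: the balls [B(p/q, psi q)] with [q] large cover [W].

   Divergence: given a cover by balls [B(a_i, r_i)] with [sum r_i ^ s <= M] and
   all [r_i] small, a point of [Exact] outside the cover is found by nesting
   balls.  A ball [B] of radius [rho] is light if the balls of the cover that
   meet it satisfy [sum r_i ^ d <= c * rho ^ d].  Inside a light ball one looks
   for a rational [p/q] and a much smaller light ball (its child), placed at
   distance almost [psi q] from [p/q].  Rationals other than [p/q] with
   denominator up to [1 / (2 q psi q)] are too far from [p/q] to matter in the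
   child, and those of larger denominator are handled at the next step because
   [sum q ^ (3 d) * psi q ^ d] converges.

   If no child is light, then the child of [p/q] is hit by finitely many balls
   [J] with [sum_J r_i ^ s] at least a constant times [psi q ^ s].  Picking
   rationals greedily, each one away from the balls that hit the previous
   children, makes these families [J] disjoint.  The room lost is at most
   a constant times [sum r_i ^ d + sum psi q ^ d], which is small, so for every
   large [k] there are about [N ^ (d + 1)] picks of denominator comparable to
   [N = 2 ^ (d k)], and [M >= c * sum_k N ^ (d + 1) * psi N ^ s], which
   contradicts the divergence of [sum q ^ d * psi q ^ s]. *)
Require Import Defs.
From HB Require Import structures.
From mathcomp Require Import all_boot all_order all_algebra.
From mathcomp Require Import all_classical all_reals all_analysis.
From mathcomp Require Import zify ring lra.

Set Implicit Arguments.
Unset Strict Implicit.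
Unset Printing Implicit Defensive.

Import Order.TTheory GRing.Theory Num.Theory.
Import numFieldNormedType.Exports.

Local Open Scope classical_set_scope.
Local Open Scope ring_scope.

(** * Lattice points, covering and Dirichlet's theorem *)

Section counting.
Context {R : realType}.
Implicit Types (d : nat) (r t h : R).

Lemma rv_norm_coord d (x : 'rV[R]_d) i : `|x ord0 i| <= `|x|.
Proof.
by rewrite [leRHS]/Num.Def.normr /= mx_normrE; apply/bigmax_geP; right; exists (ord0, i).
Qed.

Lemma rv_norm_le d (x : 'rV[R]_d) r :
  0 <= r -> (forall i, `|x ord0 i| <= r) -> `|x| <= r.
Proof.
move=> r0 xr; rewrite /Num.Def.normr /= mx_normrE; apply: bigmax_le => // -[i j] _ /=.
by rewrite ord1.
Qed.

Lemma rv_norm_lt d (x : 'rV[R]_d) r :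
  0 < r -> (forall i, `|x ord0 i| < r) -> `|x| < r.
Proof.
move=> r0 xr; rewrite /Num.Def.normr /= mx_normrE; apply: bigmax_lt => // -[i j] _ /=.
by rewrite ord1.
Qed.

Lemma rv_subE d (x y : 'rV[R]_d) i :
  (x - y) ord0 i = x ord0 i - y ord0 i.
Proof. by rewrite !mxE. Qed.

Definition rpoint d (p : 'rV[int]_d) (q : nat) : 'rV[R]_d :=
  q%:R^-1 *: map_mx intr p.

Lemma rpointE d (p : 'rV[int]_d) q i :
  rpoint p q ord0 i = (p ord0 i)%:~R / q%:R.
Proof. by rewrite !mxE mulrC. Qed.

Lemma card_ord_interval n (P : pred 'I_n) (K : nat) :
  (forall i j, P i -> P j -> (i <= j + K)%N) -> (#|P| <= K.+1)%N.
Proof.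
move=> PK; have [i0 Pi0|P0] := pickP P; last by rewrite eq_card0.
have [j0 Pj0 j0min] := arg_minnP (fun i : 'I_n => nat_of_ord i) Pi0.
rewrite cardE -(size_map (fun i : 'I_n => i - j0)%N) -(size_iota 0 K.+1).
apply: uniq_leq_size.
  rewrite map_inj_in_uniq ?enum_uniq// => u v.
  rewrite !mem_enum => /j0min ju /j0min jv uv; apply/val_inj => /=; lia.
move=> k /mapP[u]; rewrite mem_enum => Pu ->; rewrite mem_iota.
have := PK _ _ Pu Pj0; have := j0min _ Pu; lia.
Qed.

(** Balls of the maximum norm are cubes, so the count is a product over coordinates. In each
    coordinate the admissible indices span at most [2 * t / h], and [2 * t / h + 1 <= 3 * t / h]
    because [h <= t]. *)
Lemma card_grid_ball d n (x y : 'rV[R]_d) h t : 0 < h -> h <= t ->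
  #|[pred f : {ffun 'I_d -> 'I_n} |
      `|x + \row_i (h * (f i)%:R) - y| <= t]|%:R <= (3 * t / h) ^+ d.
Proof.
move=> h0 ht.
pose F (i : 'I_d) : pred 'I_n :=
  [pred j : 'I_n | `|x ord0 i + h * j%:R - y ord0 i| <= t].
have t0 : 0 <= t by lra.
pose K := Num.truncn (2 * t / h).
have K0 : 0 <= 2 * t / h by apply: divr_ge0; lra.
have /andP[K1 K2] : K%:R <= 2 * t / h < K.+1%:R := truncn_itv K0.
have FK i : (#|F i| <= K.+1)%N.
  apply: card_ord_interval => j1 j2; rewrite /F /=.
  rewrite !ler_distl => /andP[a1 a2] /andP[b1 b2].
  have : (j1%:R : R) < (j2 + K.+1)%:R.
    rewrite natrD -ltrBlDl; apply: le_lt_trans K2.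
    by rewrite ler_pdivlMr//; lra.
  by rewrite ltr_nat addnS ltnS.
apply: (@le_trans _ _ ((K.+1 ^ d)%N%:R)).
  rewrite ler_nat; apply: (@leq_trans #|family F|).
    apply: subset_leq_card; apply/fintype.subsetP => f; rewrite !inE => fy.
    apply/familyP => i; rewrite inE; apply: le_trans fy.
    by have := rv_norm_coord (x + \row_i (h * (f i)%:R) - y) i; rewrite !mxE.
  rewrite card_family.
  rewrite -[X in (_ <= _ ^ X)%N](size_enum_ord d).
  rewrite /image_mem; elim: (enum 'I_d) => //= i s IH.
  by rewrite expnS leq_mul.
rewrite natrX lerXn2r ?nnegrE//.
  by apply: divr_ge0; lra.
rewrite ler_pdivlMr// -natr1 mulrDl mul1r.
have : K%:R * h <= 2 * t by rewrite -ler_pdivlMr.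
lra.
Qed.

(* Otherwise the points of a grid of mesh [h <= t_i] lying in the ball would
   be more numerous than those lying in the small balls. *)
Lemma avoid_finitely_many_balls d (x0 : 'rV[R]_d) rho
    (L : seq ('rV[R]_d * R)) :
  0 < rho -> (forall b, b \in L -> 0 < b.2) ->
  \sum_(b <- L) (3 * b.2) ^+ d < rho ^+ d ->
  exists2 x, `|x - x0| <= rho & forall b, b \in L -> b.2 < `|x - b.1|.
Proof.
move=> rho0 L0 Lrho; apply: contrapT => /forall2NP H.
(* A single mesh below all the radii, so that [card_grid_ball] applies to every ball of [L]. *)
have [h [h0 hrho hL]] : exists h, [/\ 0 < h, h <= rho &
    forall b, b \in L -> h <= b.2].
  elim: L L0 {Lrho H} => [_|b L IH L0]; first by exists rho.
  have [|h [h0 hrho hL]] := IH; first by move=> c cL; rewrite L0// inE cL orbT.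
  exists (Num.min h b.2); split.
  - by rewrite lt_min h0 L0// inE eqxx.
  - by rewrite ge_min hrho.
  - move=> c; rewrite inE => /predU1P[->|cL]; first by rewrite ge_min lexx orbT.
    by rewrite ge_min hL.
(* The grid has [n + 1 > rho / h] points per side and stays in the cube [x0 + [0, rho]^d], whence
   the threshold [rho ^+ d]. *)
pose n := Num.truncn (rho / h).
have n0 : 0 <= rho / h by rewrite divr_ge0 ?ltW.
have /andP[n1 n2] : n%:R <= rho / h < n.+1%:R := truncn_itv n0.
pose pt (f : {ffun 'I_d -> 'I_n.+1}) := x0 + \row_i (h * (f i)%:R).
have ptx f : `|pt f - x0| <= rho.
  rewrite /pt addrC addKr; apply: rv_norm_le => [|i]; first exact: ltW.
  rewrite mxE ger0_norm ?mulr_ge0 ?ler0n// ?(ltW h0)//.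
  rewrite mulrC -ler_pdivlMr//; apply: le_trans n1.
  by rewrite ler_nat -ltnS.
have ptL f : exists2 b, b \in L & `|pt f - b.1| <= b.2.
  have [/(_ (ptx f))//|ncov] := H (pt f).
  apply: contrapT => /forall2NP nb; apply: ncov => b bL.
  by have [//|/negP] := nb b; rewrite -ltNge.
have : (#|{ffun 'I_d -> 'I_n.+1}| <=
    \sum_(b <- L) #|[pred f | (`|pt f - b.1| <= b.2)%R]|)%N.
  apply: (@leq_trans #|[pred f | has (fun b => `|pt f - b.1| <= b.2) L]|).
    apply: subset_leq_card; apply/fintype.subsetP => f _; rewrite inE.
    by have [b bL fb] := ptL f; apply/hasP; exists b.
  elim: (L) => [|b L' IH]; first by rewrite big_nil eq_card0.
  rewrite big_cons; apply: leq_trans (leq_add (leqnn _) IH).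
  rewrite -cardUI; apply: leq_trans (leq_addr _ _).
  by apply: subset_leq_card; apply/fintype.subsetP => f; rewrite !inE.
rewrite card_ffun !card_ord -(ler_nat R) natr_sum natrX => Hle.
suff : (rho / h) ^+ d < (rho / h) ^+ d by rewrite ltxx.
apply: (@le_lt_trans _ _ (n.+1%:R ^+ d)).
  by rewrite lerXn2r ?nnegrE// ltW.
apply: le_lt_trans Hle _.
apply: (@le_lt_trans _ _ (\sum_(b <- L) (3 * b.2 / h) ^+ d)).
  rewrite big_seq [leRHS]big_seq; apply: ler_sum => b bL.
  exact/card_grid_ball/hL.
under eq_bigr => b _ do rewrite expr_div_n.
rewrite -mulr_suml expr_div_n ltr_pM2r// invr_gt0 exprn_gt0//.
Qed.

Lemma integer_box d (a : 'I_d -> int) n :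
  exists s : seq 'rV[int]_d, size s = (n ^ d)%N /\
    forall p : 'rV_d, (forall i, a i <= p ord0 i < a i + n%:Z) -> p \in s.
Proof.
exists [seq \row_i (a i + (f i)%:Z) | f : {ffun 'I_d -> 'I_n}].
split; first by rewrite size_map -cardE card_ffun !card_ord.
move=> p pa; have pn i : (`|(p ord0 i - a i)%R| < n)%N by have := pa i; lia.
apply/mapP; exists [ffun i => Ordinal (pn i)]; first by rewrite mem_enum.
apply/rowP => i; rewrite mxE ffunE /=.
have -> : 0 = ord0 :> 'I_1 by exact: val_inj.
have /andP[ap _] := pa i.
by rewrite gez0_abs ?subr_ge0// addrC subrK.
Qed.

(** In each coordinate the numerators are confined to an interval of length [2 * r * q]. The list
    may contain further points. *)
Lemma rational_net d (x0 : 'rV[R]_d) r q : (0 < q)%N -> 0 <= r ->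
  exists s : seq 'rV[int]_d, (size s)%:R <= (2 * r * q%:R + 2) ^+ d /\
    forall p : 'rV_d, `|rpoint p q - x0| <= r -> p \in s.
Proof.
move=> q0 r0; have q0' : 0 < (q%:R : R) by rewrite ltr0n.
pose a (i : 'I_d) := Num.ceil (q%:R * (x0 ord0 i - r)).
have K0 : 0 <= 2 * r * q%:R by rewrite !mulr_ge0.
have /andP[K1 K2] := truncn_itv K0.
set K := Num.truncn _ in K1 K2.
have [s [ss sP]] := integer_box a K.+2.
exists s; split.
  rewrite ss natrX lerXn2r ?nnegrE//; first by rewrite addr_ge0.
  by rewrite -addn2 natrD lerD2r.
move=> p pr; apply: sP => i.
have := le_trans (rv_norm_coord _ i) pr.
rewrite rv_subE rpointE ler_distl => /andP[].
rewrite ler_pdivlMr// ler_pdivrMr// => p1 p2.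
have -> /= : a i <= p ord0 i.
  by rewrite /a ceil_le_int// mulrC.
rewrite -(ltr_int R) intrD.
have := ceil_ge (q%:R * (x0 ord0 i - r)); rewrite -/(a i) => a1.
rewrite -[K.+2%:~R]pmulrn -natr1.
by apply: le_lt_trans p2 _; lra.
Qed.

(** Pigeonhole: the fractional parts of [q * x] for [0 <= q <= m ^ d] fall into [m ^ d] cubes of
    side [1 / m]. Two values of [q] sharing a cube give the denominator as their difference. *)
Lemma simultaneous_dirichlet d m (x : 'rV[R]_d) : (0 < m)%N ->
  exists q, exists p : 'rV[int]_d, (0 < q <= m ^ d)%N /\
    `|x - rpoint p q| < (q%:R * m%:R)^-1.
Proof.
move=> m0; have m0' : 0 < (m%:R : R) by rewrite ltr0n.
pose fr (q : nat) (i : 'I_d) : R := q%:R * x ord0 i - (Num.floor (q%:R * x ord0 i))%:~R.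
have fr1 q i : 0 <= fr q i < 1.
  have /andP[? ?] := floor_itv (q%:R * x ord0 i).
  by rewrite /fr subr_ge0 ltrBlDl; apply/andP; split=> //; rewrite -intrD1.
have fm q i : (Num.truncn (m%:R * fr q i)%R < m)%N.
  have /andP[f0 f1] := fr1 q i.
  have mf0 : 0 <= m%:R * fr q i by rewrite mulr_ge0.
  have /andP[t1 t2] := truncn_itv mf0.
  by rewrite -(ltr_nat R); apply: le_lt_trans t1 _; rewrite gtr_pMr.
pose F (q : 'I_(m ^ d).+1) : {ffun 'I_d -> 'I_m} := [ffun i => Ordinal (fm q i)].
have [q1 [q2 [q12 FF]]] : exists q1 q2 : 'I_(m ^ d).+1, (q1 < q2)%N /\ F q1 = F q2.
  apply: contrapT => Fninj.
  have Finj : injective F.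
    move=> q1 q2 Fq; apply/val_inj => /=.
    case: (ltngtP q1 q2) => // q12; exfalso; apply: Fninj.
      by exists q1, q2.
    by exists q2, q1.
  have := leq_card _ Finj; rewrite card_ffun !card_ord; lia.
exists (q2 - q1)%N.
exists (\row_i (Num.floor (q2%:R * x ord0 i) - Num.floor (q1%:R * x ord0 i))).
split; first by rewrite subn_gt0 q12 (leq_trans (leq_subr _ _))// -ltnS.
have q0 : 0 < ((q2 - q1)%N%:R : R) by rewrite ltr0n subn_gt0.
apply: rv_norm_lt => [|i]; first by rewrite invr_gt0 mulr_gt0.
rewrite rv_subE rpointE mxE.
have -> : x ord0 i - (Num.floor (q2%:R * x ord0 i) - Num.floor (q1%:R * x ord0 i))%:~R
   / (q2 - q1)%N%:R = (fr q2 i - fr q1 i) / (q2 - q1)%N%:R.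
  rewrite /fr rmorphB /= natrB ?(ltnW q12)//.
  rewrite natrB ?(ltnW q12)// in q0.
  by field; rewrite gt_eqF.
rewrite normrM normfV (gtr0_norm q0) invfM mulrC ltr_pM2l ?invr_gt0//.
have /ffunP/(_ i) := FF; rewrite !ffunE => -[E].
have /andP[f0 f1] := fr1 q1 i; have /andP[g0 g1] := fr1 q2 i.
have mf0 : 0 <= m%:R * fr q1 i by rewrite mulr_ge0.
have mg0 : 0 <= m%:R * fr q2 i by rewrite mulr_ge0.
have /andP[t1 t2] := truncn_itv mf0.
have /andP[u1 u2] := truncn_itv mg0.
rewrite -E in u1 u2; rewrite -natr1 in t2 u2.
rewrite -[ltRHS]mul1r ltr_pdivlMr// -[X in _ * X](gtr0_norm m0') -normrM.
by rewrite ltr_norml; lra.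
Qed.

(** In a coordinate where they differ, the difference is a nonzero integer over [q * q']. *)
Lemma rpoint_eq_or_far d (p p' : 'rV[int]_d) q q' : (0 < q)%N -> (0 < q')%N ->
  rpoint p q = rpoint p' q' \/
  (q%:R * q'%:R)^-1 <= `|rpoint p q - rpoint p' q'| :> R.
Proof.
move=> q0 q'0; have q0' : 0 < (q%:R : R) by rewrite ltr0n.
have q'0' : 0 < (q'%:R : R) by rewrite ltr0n.
have [|neq] := pselect (rpoint p q = rpoint p' q'); first by left.
right; have [i /eqP ni] : exists i, rpoint p q ord0 i != rpoint p' q' ord0 i.
  by apply: contrapT => /forallNP H; apply/neq/rowP => i; apply/eqP/negP => /negP /(H i).
apply: le_trans (rv_norm_coord _ i); rewrite rv_subE.
move: ni; rewrite !rpointE => ni.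
have E : (p ord0 i)%:~R / q%:R - (p' ord0 i)%:~R / q'%:R =
   (p ord0 i * q'%:Z - p' ord0 i * q%:Z)%:~R / (q%:R * q'%:R) :> R.
  by rewrite rmorphB !rmorphM /= -!pmulrn; field; rewrite !gt_eqF.
rewrite E normrM normfV (gtr0_norm (mulr_gt0 q0' q'0')) ler_peMl ?invr_ge0 ?mulr_ge0//.
rewrite -intr_norm ler1z; set z := (_ - _)%R.
suff : z != 0 by lia.
apply/eqP => z0; apply: ni; apply/eqP; rewrite -subr_eq0 E -/z z0 mul0r//.
Qed.

End counting.

(** * Series *)

Section real_series.
Context {R : realType}.
Implicit Types (f psi : nat -> R).

Lemma eseries_lt_pinftyP f : (forall q, (1 <= q)%N -> 0 <= f q) ->
  (\sum_(1 <= q <oo) (f q)%:E < +oo)%E <->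
  exists M, forall N, \sum_(1 <= q < N) f q <= M.
Proof.
move=> f0.
have f0' q : (1 <= q)%N -> true -> (0 <= (f q)%:E)%E by move=> /f0; rewrite lee_fin.
split=> [flt|[M fM]].
  have ffin : (\sum_(1 <= q <oo) (f q)%:E \is a fin_num)%E.
    by rewrite ge0_fin_numE//; apply: nneseries_ge0 => q q1 _; exact: f0'.
  exists (fine (\sum_(1 <= q <oo) (f q)%:E)%E) => N.
  by rewrite -lee_fin fineK// -sumEFin; apply: nneseries_lim_ge.
apply: (@le_lt_trans _ _ M%:E); last exact: ltry.
apply: lime_le; first exact: is_cvg_nneseries.
by apply: nearW => N; rewrite sumEFin lee_fin.
Qed.

Lemma bounded_series_tail f : (forall q, (1 <= q)%N -> 0 <= f q) ->
  (exists M, forall N, \sum_(1 <= q < N) f q <= M) ->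
  forall e, 0 < e -> exists2 Q0, (0 < Q0)%N &
    forall Q N, (Q0 <= Q)%N -> \sum_(Q <= q < N) f q <= e.
Proof.
move=> f0 [M fM] e e0.
pose E := [set y | exists N, y = \sum_(1 <= q < N) f q].
have supE : has_sup E.
  split; first by exists (\sum_(1 <= q < 0) f q), 0%N.
  by exists M => _ [N ->].
have [_ [N0 ->] N0e] := sup_adherent e0 supE.
exists N0.+1 => // Q N Q0.
have [QN|NQ] := leqP Q N; last by rewrite big_geq ?ltW// ltnW.
have : \sum_(1 <= q < N) f q <= sup E by apply: ub_le_sup; [case: supE|exists N].
rewrite (big_cat_nat (n := Q))/=; [|lia|by []].
have : \sum_(1 <= q < N0) f q <= \sum_(1 <= q < Q) f q.
  have [N01|N01] := leqP 1 N0; last first.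
    by rewrite big_geq 1?ltnW// big_nat sumr_ge0// => q /andP[/f0].
  rewrite (big_cat_nat (n := N0) (p := Q))/=; [|lia|lia].
  rewrite lerDl big_nat sumr_ge0// => q /andP[? _]; apply: f0; lia.
lra.
Qed.

(** Cauchy condensation: the block from [D ^ k] to [D ^ k.+1] has fewer than [D ^ k.+1] terms, each
    bounded through the monotonicity of [psi] by its value at the left end. *)
Lemma condensation_upper psi d (s : R) D : (1 < D)%N -> 0 <= s ->
  (forall q, (1 <= q)%N -> 0 < psi q) ->
  (forall q r, (1 <= q)%N -> (q <= r)%N -> psi r <= psi q) ->
  forall K, \sum_(1 <= q < D ^ K) (q%:R ^+ d * psi q `^ s) <=
    D%:R ^+ d.+1 * \sum_(0 <= k < K) ((D ^ k)%:R ^+ d.+1 * psi (D ^ k)%N `^ s).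
Proof.
move=> D1 s0 psi0 psid; elim=> [|K IH]; first by rewrite expn0 !big_geq// mulr0.
have DK : (0 < D ^ K)%N by rewrite expn_gt0; lia.
rewrite (big_cat_nat (n := (D ^ K)%N))/=; [|lia|by rewrite leq_exp2l].
rewrite big_nat_recr//= mulrDr; apply: lerD => //.
apply: (@le_trans _ _
    (\sum_(D ^ K <= q < D ^ K.+1) ((D ^ K.+1)%:R ^+ d * psi (D ^ K)%N `^ s))).
  apply: ler_sum_nat => q /andP[q1 q2].
  apply: ler_pM; rewrite ?exprn_ge0 ?powR_ge0//.
    by rewrite lerXn2r ?nnegrE// ler_nat ltnW.
  have q0 : (0 < q)%N by lia.
  by rewrite ge0_ler_powR ?nnegrE ?(ltW (psi0 _ _))// psid.
rewrite sumr_const_nat -[leLHS]mulr_natl !mulrA ler_wpM2r ?powR_ge0//.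
apply: (@le_trans _ _ ((D ^ K.+1)%:R ^+ d.+1)).
  by rewrite exprS ler_wpM2r ?exprn_ge0// ler_nat leq_subr.
by rewrite -exprMn -natrM expnS.
Qed.

(** Applied with [D = 2 ^ d], whose powers are the bounds [m ^ d], [m = 2 ^ k], that Dirichlet's
    theorem puts on denominators. *)
Lemma divergent_condensation psi d (s : R) D : (1 < D)%N -> 0 <= s ->
  (forall q, (1 <= q)%N -> 0 < psi q) ->
  (forall q r, (1 <= q)%N -> (q <= r)%N -> psi r <= psi q) ->
  (\sum_(1 <= q <oo) (q%:R ^+ d * psi q `^ s)%:E = +oo)%E ->
  forall k0 M, exists K,
    M < \sum_(k0 <= k < K) ((D ^ k)%:R ^+ d.+1 * psi (D ^ k)%N `^ s).
Proof.
move=> D1 s0 psi0 psid div k0 M; apply: contrapT => /forallNP H.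
pose g k := (D ^ k)%:R ^+ d.+1 * psi (D ^ k)%N `^ s : R.
have g0 k : 0 <= g k by rewrite mulr_ge0 ?exprn_ge0 ?powR_ge0.
suff : (\sum_(1 <= q <oo) (q%:R ^+ d * psi q `^ s)%:E < +oo)%E by rewrite div ltxx.
apply/eseries_lt_pinftyP => [q _|]; first by rewrite mulr_ge0 ?exprn_ge0 ?powR_ge0.
exists (D%:R ^+ d.+1 * (\sum_(0 <= k < k0) g k + M)) => N.
pose K := (N + k0)%N.
have ND : (N <= D ^ K)%N.
  by rewrite (leq_trans _ (ltnW (ltn_expl K D1)))// leq_addr.
apply: (@le_trans _ _ (\sum_(1 <= q < D ^ K) (q%:R ^+ d * psi q `^ s))).
  have [N0|N0] := leqP 1 N; last first.
    rewrite big_geq 1?ltnW// sumr_ge0// => q _.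
    by rewrite mulr_ge0 ?exprn_ge0 ?powR_ge0.
  rewrite (big_cat_nat (n := N) (p := (D ^ K)%N))//= lerDl sumr_ge0// => q _.
  by rewrite mulr_ge0 ?exprn_ge0 ?powR_ge0.
apply: le_trans (condensation_upper d D1 s0 psi0 psid K) _.
rewrite ler_wpM2l ?exprn_ge0//.
rewrite (big_cat_nat (n := k0))/= ?leq_addl// lerD2l.
by rewrite leNgt; apply/negP/H.
Qed.

End real_series.

Section approximating_function.
Context {R : realType} (d : nat) (psi : nat -> R).
Context (d_ge1 : (1 <= d)%N)
  (psi_gt0 : forall q : nat, (1 <= q)%N -> 0 < psi q)
  (psi_sum : (\sum_(1 <= q <oo) (q%:R ^+ (3 * d) * psi q ^+ d)%:E < +oo)%E).

Lemma psi_tail e : 0 < e -> exists2 Q0, (0 < Q0)%N &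
  forall Q N, (Q0 <= Q)%N -> \sum_(Q <= q < N) (q%:R ^+ (3 * d) * psi q ^+ d) <= e.
Proof.
have f0 q : (1 <= q)%N -> 0 <= q%:R ^+ (3 * d) * psi q ^+ d.
  by move=> /psi_gt0/ltW p0; rewrite mulr_ge0 ?exprn_ge0.
apply: bounded_series_tail => //.
exact/eseries_lt_pinftyP.
Qed.

(** A single term of the tail is at most [e ^+ d]; take [d]-th roots. *)
Lemma psi_cubic_decay e : 0 < e -> exists2 Q0, (0 < Q0)%N &
  forall q, (Q0 <= q)%N -> q%:R ^+ 3 * psi q <= e.
Proof.
move=> e0; have [Q0 Q0gt0 H] := psi_tail (exprn_gt0 d e0).
exists Q0 => // q Q0q; have p0 : 0 < psi q by apply: psi_gt0; lia.
have := H q q.+1 Q0q; rewrite big_nat1 exprM -exprMn ler_pXn2r ?nnegrE//.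
- by rewrite mulr_ge0 ?exprn_ge0// ltW.
- exact: ltW.
Qed.

End approximating_function.

(** * Rationals of prescribed size far from given balls *)

Section selection.
Context {R : realType} (d : nat) (psi : nat -> R).
Context (d_ge1 : (1 <= d)%N)
  (psi_gt0 : forall q : nat, (1 <= q)%N -> 0 < psi q).

(** Picked denominators lie between [N / spread] and [N]. With this value the Dirichlet gaps around
    rationals of denominator at most [N / spread] cost at most a quarter of [(rho / 2) ^+ d], see
    [S1] in [rational_balls]. *)
Definition spread := (8 * (4 * 4 * 6) ^ d)%N.
(** With this value the gaps [4 * psi q] for [q > Q] cost at most another quarter of
    [(rho / 2) ^+ d], see [S2] in [rational_balls]. *)
Definition vol_const : R := (4 * (2 * 4 * 4 * 6) ^+ d)^-1.

Lemma spread_gt0 : (0 < spread)%N.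
Proof. by rewrite muln_gt0 expn_gt0. Qed.

Lemma vol_const_gt0 : 0 < vol_const.
Proof. by rewrite invr_gt0 mulr_gt0// exprn_gt0// !mulr_gt0. Qed.

Lemma expr_add_le n (x y : R) : 0 <= x -> 0 <= y ->
  (x + y) ^+ n <= 2 ^+ n * (x ^+ n + y ^+ n).
Proof.
move=> x0 y0; wlog xy : x y x0 y0 / x <= y.
  by move=> H; have [|/ltW] := leP x y => /H; [exact|rewrite addrC [X in _ * X]addrC; exact].
apply: (@le_trans _ _ ((2 * y) ^+ n)).
  by rewrite lerXn2r ?nnegrE ?addr_ge0 ?mulr_ge0//; lra.
by rewrite exprMn ler_wpM2l ?exprn_ge0// lerDr exprn_ge0.
Qed.

Lemma sum_ltn_const J n : \sum_(1 <= q < n) ((q < J)%N%:R : R) <= J%:R.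
Proof.
rewrite -natr_sum ler_nat; case: n => [|n]; first by rewrite big_geq.
suff : (\sum_(1 <= q < n.+1) (q < J) <= minn n J)%N by lia.
elim: n => [|n IH]; first by rewrite big_geq.
by rewrite big_nat_recr//=; case: ltnP; lia.
Qed.

(* The denominators [q < J] are negligible for large [m]; for the others
   [rho * q + 1 <= 2 * rho * q]. *)
Lemma dirichlet_balls_volume (rho : R) m J M : 0 < rho <= 1 -> (0 < m)%N ->
  rho^-1 <= J%:R ->
  \sum_(1 <= q < M.+1) ((rho * q%:R + 1) ^+ d * (q%:R * m%:R)^-1 ^+ d) <=
  2 ^+ d * (J%:R + rho ^+ d * M%:R) / m%:R ^+ d.
Proof.
move=> /andP[rho0 rho1] m0 rhoJ.
have J0 : 0 <= (J%:R : R) by [].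
apply: (@le_trans _ _ (\sum_(1 <= q < M.+1)
    (2 ^+ d * ((q < J)%N%:R + rho ^+ d) / m%:R ^+ d))).
  apply: ler_sum_nat => q /andP[q0 _].
  have q0' : 0 < (q%:R : R) by rewrite ltr0n.
  rewrite -exprMn invfM mulrA exprMn -exprVn ler_wpM2r ?exprn_ge0 ?invr_ge0//.
  have -> : (rho * q%:R + 1) / q%:R = rho + q%:R^-1 by field; rewrite gt_eqF.
  have q1 : q%:R^-1 <= 1 :> R by rewrite invf_le1// ler1n.
  have qi0 : 0 <= q%:R^-1 :> R by rewrite invr_ge0.
  case: ltnP => [qJ|Jq] /=.
    apply: (@le_trans _ _ (2 ^+ d)); first by rewrite lerXn2r ?nnegrE ?addr_ge0//; lra.
    by rewrite ler_peMr ?exprn_ge0// lerDl exprn_ge0// ltW.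
  rewrite add0r -exprMn lerXn2r ?nnegrE ?addr_ge0 ?mulr_ge0 ?(ltW rho0)//.
  suff : q%:R^-1 <= rho by lra.
  rewrite -[leRHS]invrK lef_pV2 ?posrE ?invr_gt0//.
  by apply: le_trans rhoJ _; rewrite ler_nat.
rewrite -mulr_suml -mulr_sumr ler_wpM2r ?invr_ge0 ?exprn_ge0//.
rewrite ler_wpM2l ?exprn_ge0// big_split/= lerD ?sum_ltn_const//.
by rewrite sumr_const_nat subn1 mulr_natr.
Qed.

Lemma sum_indicator_tail (t : nat -> R) Q n :
  \sum_(1 <= q < n) ((Q < q)%N%:R * t q) = \sum_(Q.+1 <= q < n) t q.
Proof.
elim: n => [|n IH]; first by rewrite !big_geq.
have [->|n0] := posnP n; first by rewrite !big_geq.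
rewrite big_nat_recr//= IH; have [Qn|nQ] := leqP Q.+1 n.
  by rewrite [RHS]big_nat_recr//= mul1r.
by rewrite mul0r addr0 !big_geq// ltnW.
Qed.

Variables (x0 : 'rV[R]_d) (rho : R) (Q : nat).
Hypotheses (rho01 : 0 < rho <= 1)
  (psi_vol : forall N, \sum_(Q.+1 <= q < N) ((rho * q%:R + 1) ^+ d * psi q ^+ d)
     <= vol_const * rho ^+ d).

(** The first term prevents a Dirichlet approximation of small denominator; the second separates the
    picked rational from the others of level above [Q]. It is affordable by [psi_vol], since about
    [(rho * q + 1) ^ d] rationals of denominator [q] lie near the ball. *)
Let gap m q := (q%:R * m%:R)^-1 + (Q < q)%N%:R * (4 * psi q) : R.

Lemma gap_gt0 m q : (0 < m)%N -> (0 < q)%N -> 0 < gap m q.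
Proof.
move=> m0 q0; rewrite ltr_pwDl ?invr_gt0 ?mulr_gt0 ?ltr0n//.
by rewrite mulr_ge0// mulr_ge0// ltW// psi_gt0.
Qed.

(** One term of [psi_vol] already bounds [psi q ^+ d] by [vol_const * rho ^+ d], and [vol_const] is
    at most [8 ^- d]. *)
Lemma psi_le_radius q : (Q < q)%N -> 4 * psi q <= rho / 2.
Proof.
move=> Qq; have /andP[rho0 rho1] := rho01.
have H : ((rho * q%:R + 1) * psi q) ^+ d <= vol_const * rho ^+ d.
  apply: le_trans (psi_vol q.+1); rewrite big_nat_recr//= exprMn lerDr.
  rewrite big_nat sumr_ge0// => i /andP[Qi _].
  have p0 : 0 < psi i by apply: psi_gt0; lia.
  by rewrite mulr_ge0 ?exprn_ge0 ?(ltW p0)// addr_ge0// mulr_ge0// ltW.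
have p0 : 0 < psi q by apply: psi_gt0; lia.
suff : psi q <= rho / 8 by lra.
rewrite -(@ler_pXn2r _ d)// ?nnegrE ?(ltW p0) ?divr_ge0 ?(ltW rho0)//.
apply: (@le_trans _ _ (vol_const * rho ^+ d)).
  apply: le_trans H; rewrite lerXn2r ?nnegrE ?(ltW p0)//.
    by rewrite mulr_ge0 ?(ltW p0)// addr_ge0// mulr_ge0// ltW.
  by rewrite ler_peMl ?(ltW p0)// lerDr mulr_ge0// ltW.
rewrite expr_div_n mulrC ler_wpM2l ?exprn_ge0 ?(ltW rho0)//.
rewrite lef_pV2 ?posrE ?mulr_gt0 ?exprn_gt0//.
apply: (@le_trans _ _ ((2 * 4 * 4 * 6) ^+ d)); first by rewrite lerXn2r ?nnegrE//; lra.
by rewrite ler_peMl ?exprn_ge0//; lra.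
Qed.

(** The balls are centred at the rationals near [x0] and have the gaps as radii. The condition on
    [J] makes the denominators below [1 / rho] negligible, the one on [M] controls the others; half
    of [(rho / 2) ^+ d] remains for further balls to avoid. *)
Lemma rational_balls m J M : (0 < m)%N -> m%:R^-1 <= rho / 2 ->
  rho^-1 <= J%:R -> J%:R * spread%:R <= rho ^+ d * m%:R ^+ d ->
  (M * spread <= m ^ d)%N ->
  exists L : seq ('rV[R]_d * R), [/\ forall b, b \in L -> 0 < b.2,
    \sum_(b <- L) (3 * b.2) ^+ d <= 2^-1 * (rho / 2) ^+ d &
    forall x, `|x - x0| <= rho / 2 -> (forall b, b \in L -> b.2 < `|x - b.1|) ->
      forall p q, (0 < q <= M)%N -> gap m q < `|x - rpoint p q|].
Proof.
move=> m0 mrho rhoJ JN MN; have /andP[rho0 rho1] := rho01.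
have m0' : 0 < (m%:R : R) by rewrite ltr0n.
have rho20 : 0 <= 2 * rho by lra.
have ex_net q : exists s : seq 'rV[int]_d, (0 < q)%N ->
    (size s)%:R <= (2 * (2 * rho) * q%:R + 2) ^+ d /\
    forall p : 'rV_d, `|rpoint p q - x0| <= 2 * rho -> p \in s.
  have [q0|q0] := posnP q; first by exists [::]; rewrite q0.
  by have [s Hs] := rational_net x0 q0 rho20; exists s.
have [net netP] := choice ex_net.
exists [seq (rpoint p q, gap m q) | q <- index_iota 1 M.+1, p <- net q].
split.
- move=> b /allpairsPdep[q [p [qM _ ->]]] /=; apply: gap_gt0 => //.
  by move: qM; rewrite mem_index_iota => /andP[].
- rewrite big_allpairs_dep/=.
  (* The net has at most [(4 * (rho * q + 1)) ^ d] points; [6] is the [3] of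
     [avoid_finitely_many_balls] times the [2] of [expr_add_le], and the [psi] term brings one more
     [4]. *)
  apply: (@le_trans _ _ (\sum_(1 <= q < M.+1) ((4 * 6) ^+ d *
      ((rho * q%:R + 1) ^+ d * (q%:R * m%:R)^-1 ^+ d) +
      (4 * 4 * 6) ^+ d * ((Q < q)%N%:R * ((rho * q%:R + 1) ^+ d * psi q ^+ d))))).
    apply: ler_sum_nat => q /andP[q0 _].
    have p0 := psi_gt0 q0.
    have [netq _] := netP _ q0.
    rewrite big_const_seq count_predT iter_addr_0 -[leLHS]mulr_natl.
    have q0' : 0 < (q%:R : R) by rewrite ltr0n.
    have rq0 : 0 <= rho * q%:R by rewrite mulr_ge0// ltW.
    have qm0 : 0 <= (q%:R * m%:R)^-1 :> R by rewrite invr_ge0 mulr_ge0.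
    apply: (@le_trans _ _ ((4 * (rho * q%:R + 1)) ^+ d *
        (6 ^+ d * ((q%:R * m%:R)^-1 ^+ d + (Q < q)%N%:R * (4 * psi q) ^+ d)))).
      apply: ler_pM; rewrite ?exprn_ge0// ?mulr_ge0 ?(ltW (gap_gt0 _ _))//.
        apply: le_trans netq _; rewrite lerXn2r ?nnegrE//; lra.
      rewrite -[6]/(3 * 2)%:R natrM exprMn [in leRHS]exprMn -mulrA ler_wpM2l ?exprn_ge0//.
      apply: le_trans (expr_add_le _ qm0 _) _.
        by rewrite mulr_ge0// mulr_ge0// ltW.
      rewrite ler_wpM2l ?exprn_ge0// lerD2l exprMn ler_wpM2r ?exprn_ge0 ?mulr_ge0 ?(ltW p0)//.
      by case: (Q < q)%N => /=; rewrite ?expr1n// expr0n; case: (d) d_ge1.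
    rewrite !exprMn; set A := (_ + 1) ^+ d; set B := _ ^-1 ^+ d; set C := psi q ^+ d.
    by rewrite le_eqVlt; apply/orP; left; apply/eqP; ring.
  rewrite big_split/= -!mulr_sumr.
  have md0 : 0 < (m%:R : R) ^+ d by rewrite exprn_gt0.
  have b0 : 0 < (spread%:R : R) by rewrite ltr0n spread_gt0.
  have r0 : 0 < rho ^+ d by rewrite exprn_gt0.
  have E1 : \sum_(1 <= q < M.+1) ((rho * q%:R + 1) ^+ d * (q%:R * m%:R)^-1 ^+ d)
      <= 2 ^+ d * (2 * rho ^+ d / spread%:R).
    apply: le_trans (dirichlet_balls_volume M rho01 m0 rhoJ) _.
    rewrite -mulrA ler_wpM2l ?exprn_ge0// ler_pdivrMr// mulrAC ler_pdivlMr//.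
    rewrite mulrDl -[2]/(1 + 1) mulrDl mul1r mulrDl lerD//.
    rewrite -mulrA ler_wpM2l ?(ltW r0)// -natrM -natrX ler_nat.
    exact: MN.
  have E2 : \sum_(1 <= q < M.+1)
      ((Q < q)%N%:R * ((rho * q%:R + 1) ^+ d * psi q ^+ d)) <= vol_const * rho ^+ d.
    by rewrite sum_indicator_tail; exact: psi_vol.
  have S1 : (4 * 6) ^+ d * (2 ^+ d * (2 * rho ^+ d / spread%:R)) = 4^-1 * (rho / 2) ^+ d.
    have four : 4 ^+ d = 2 ^+ d * 2 ^+ d :> R.
      by rewrite -exprMn; congr (_ ^+ _); ring.
    rewrite expr_div_n /spread natrM natrX !natrM !exprMn four.
    by field; rewrite !expf_neq0.
  have S2 : (4 * 4 * 6) ^+ d * (vol_const * rho ^+ d) = 4^-1 * (rho / 2) ^+ d.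
    rewrite expr_div_n /vol_const !exprMn.
    by field; rewrite !expf_neq0.
  have -> : 2^-1 * (rho / 2) ^+ d = 4^-1 * (rho / 2) ^+ d + 4^-1 * (rho / 2) ^+ d by field.
  rewrite -{1}S1 -S2 lerD// ler_wpM2l ?exprn_ge0//.
- move=> x xx0 xL p q /andP[q0 qM].
  have [_ netq] := netP _ q0.
  have [pn|np] := boolP (p \in net q).
    have /= := xL (rpoint p q, gap m q); apply.
    by apply/allpairsPdep; exists q, p; rewrite mem_index_iota q0 ltnS.
  (* Outside the net no ball is required: [x] is within [rho / 2] of [x0], so such a rational is
     farther from [x] than [rho], which bounds the gap. *)
  have far : 2 * rho < `|rpoint p q - x0|.
    by rewrite ltNge; apply/negP => /netq; apply/negP.
  have : gap m q <= rho.
    have := @psi_le_radius q; rewrite /gap.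
    have : (q%:R * m%:R)^-1 <= rho / 2.
      apply: le_trans mrho; rewrite lef_pV2 ?posrE ?mulr_gt0 ?ltr0n//.
      by rewrite ler_peMl ?ler1n.
    case: (Q < q)%N => /= ? H; last by lra.
    by have := H isT; lra.
  have := ler_distD x (rpoint p q) x0; rewrite (distrC _ x).
  lra.
Qed.


Context (psi_sum :
  (\sum_(1 <= q <oo) (q%:R ^+ (3 * d) * psi q ^+ d)%:E < +oo)%E).

(* [x] is taken away from the given balls and from the rationals of small
   denominator; Dirichlet's theorem then yields a rational near [x] whose
   denominator is automatically large. *)
Lemma pick_rational : exists k0, forall k, (k0 <= k)%N ->
  let m := (2 ^ k)%N in let N := (m ^ d)%N in
  forall L : seq ('rV[R]_d * R), (forall b, b \in L -> 0 <= b.2) ->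
  \sum_(b <- L) (b.2 + spread%:R / (m%:R * N%:R)) ^+ d <= vol_const * rho ^+ d ->
  exists (p : 'rV[int]_d) q,
    [/\ (0 < q <= N)%N, (N < spread * q)%N, `|rpoint p q - x0| <= 3 / 4 * rho,
      (forall p' q', (0 < q' < q)%N -> rpoint p' q' <> rpoint p q :> 'rV[R]_d) &
      (forall p' q', (Q < q' <= q)%N -> rpoint p' q' <> rpoint p q :> 'rV[R]_d ->
         2 * psi q' <= `|rpoint p q - rpoint p' q'|)] /\
    forall b, b \in L -> b.2 < `|rpoint p q - b.1|.
Proof.
have /andP[rho0 rho1] := rho01.
have b0 : 0 < (spread%:R : R) by rewrite ltr0n spread_gt0.
have r0 : 0 < rho ^+ d by rewrite exprn_gt0.
have e0 : 0 < (4 * spread%:R)^-1 :> R by rewrite invr_gt0 mulr_gt0.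
have [Q1 Q10 psi3] := psi_cubic_decay d_ge1 psi_gt0 psi_sum e0.
pose J := (Num.truncn rho^-1).+1.
have rhoJ : rho^-1 <= J%:R.
  by have /andP[_ /ltW] := truncn_itv (ltW (etrans (invr_gt0 rho) rho0)).
(* The four summands serve, in order, [m1], [JN], [Q1q'] and [sN] below. *)
pose A : R := 2 / rho + J%:R * spread%:R / rho ^+ d + 2 * spread%:R * Q1%:R
   + 4 * spread%:R / rho.
exists (Num.truncn A) => k Ak m N L L0 Lvol.
have A1 : 0 <= 2 / rho by rewrite divr_ge0 ?(ltW rho0).
have A2 : 0 <= J%:R * spread%:R / rho ^+ d by rewrite divr_ge0 ?(ltW r0)// mulr_ge0.
have A3 : 0 <= 2 * spread%:R * Q1%:R :> R by rewrite mulr_ge0// mulr_ge0.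
have A4 : 0 <= 4 * spread%:R / rho by rewrite divr_ge0 ?(ltW rho0)// mulr_ge0.
have A0 : 0 <= A by rewrite !addr_ge0.
have m0 : (0 < m)%N by rewrite expn_gt0.
have Am : A <= m%:R.
  have /andP[_ /ltW H] := truncn_itv A0; apply: le_trans H _.
  by rewrite ler_nat; apply: leq_ltn_trans Ak (ltn_expl _ _).
have NE : N = (m ^ d)%N by [].
clearbody N m.
have mN : (m <= N)%N by rewrite NE -{1}(expn1 m) leq_pexp2l.
have m0' : 0 < (m%:R : R) by rewrite ltr0n.
have N0' : 0 < (N%:R : R) by rewrite ltr0n (leq_trans m0).
have mN' : m%:R <= N%:R :> R by rewrite ler_nat.
have m1 : m%:R^-1 <= rho / 2.
  rewrite -[leRHS]invrK lef_pV2 ?posrE ?invr_gt0 ?divr_gt0// invf_div.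
  by apply: le_trans Am; rewrite /A; lra.
have JN : J%:R * spread%:R <= rho ^+ d * m%:R ^+ d.
  rewrite [leRHS]mulrC -ler_pdivrMr// -natrX -NE.
  by apply: le_trans (le_trans Am mN'); rewrite /A; lra.
have sN : spread%:R / (m%:R * N%:R) <= rho / 4.
  rewrite invfM mulrCA.
  have : spread%:R / N%:R <= rho / 4.
    rewrite ler_pdivrMr// mulrAC ler_pdivlMr// [leRHS]mulrC -ler_pdivrMr//.
    by apply: le_trans (le_trans Am mN'); rewrite /A [spread%:R * 4]mulrC; lra.
  apply: le_trans; rewrite ler_piMl ?divr_ge0 ?(ltW b0) ?(ltW N0')//.
  by rewrite invf_le1// ler1n.
have MN : (N %/ spread * spread <= m ^ d)%N by rewrite -NE leq_trunc_div.
have [L' [L'0 L'vol L'gap]] := rational_balls m0 m1 rhoJ JN MN.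
set sg := spread%:R / (m%:R * N%:R) in Lvol sN *.
have sg0 : 0 < sg by rewrite divr_gt0// mulr_gt0.
(* The balls of [L] are enlarged by [sg] because the rational found near [x] is only known to lie
   within [sg] of it. *)
have [|||x xx0 xL] := @avoid_finitely_many_balls R d x0 (rho / 2)
    (L' ++ [seq (b.1, b.2 + sg) | b <- L]).
- by rewrite divr_gt0.
- move=> b; rewrite mem_cat => /orP[/L'0//|/mapP[c cL ->]] /=.
  by have := L0 _ cL; lra.
- rewrite big_cat big_map/=; apply: (@le_lt_trans _ _
      (2^-1 * (rho / 2) ^+ d + 4^-1 * (rho / 2) ^+ d)); last first.
    by have : 0 < (rho / 2) ^+ d by [rewrite exprn_gt0// divr_gt0]; lra.
  apply: lerD => //.
  under eq_bigr do rewrite exprMn.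
  rewrite -mulr_sumr; apply: (@le_trans _ _ (3 ^+ d * (vol_const * rho ^+ d))).
    by rewrite ler_wpM2l ?exprn_ge0.
  have -> : 3 ^+ d * (vol_const * rho ^+ d) =
      4^-1 * (rho / 2) ^+ d * (3 / (4 * 4 * 6)) ^+ d.
    rewrite /vol_const !expr_div_n !exprMn; by field; rewrite !expf_neq0.
  rewrite ler_piMr ?exprn_ile1// ?mulr_ge0 ?exprn_ge0 ?divr_ge0 ?(ltW rho0)//; lra.
have [q0 [p0 [q0N q0x]]] := simultaneous_dirichlet x m0; rewrite -NE in q0N.
(* The least denominator satisfying Dirichlet's inequality is taken: the same rational written with
   a smaller denominator would satisfy it as well. *)
have exq : exists q, `[< (0 < q <= N)%N /\ exists p : 'rV[int]_d,
    `|x - rpoint p q| < (q%:R * m%:R)^-1 >].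
  by exists q0; apply/asboolP; split=> //; exists p0.
have [q /asboolP[/andP[q1 qN] [p px]] qmin] := ex_minnP exq.
have q1' : 0 < (q%:R : R) by rewrite ltr0n.
(* Otherwise [q <= N %/ spread], and the choice of [x] outside the gaps contradicts [px]. *)
have Nq : (N < spread * q)%N.
  rewrite mulnC -ltn_divLR ?spread_gt0// ltnNge; apply/negP => qN'.
  have xq : forall b, b \in L' -> b.2 < `|x - b.1|.
    by move=> b bL; apply: xL; rewrite mem_cat bL.
  have := L'gap x xx0 xq p q; rewrite q1 qN' => /(_ isT).
  have : 0 <= (Q < q)%N%:R * (4 * psi q) by rewrite mulr_ge0// mulr_ge0// ltW// psi_gt0.
  rewrite /gap; lra.
have qsg : (q%:R * m%:R)^-1 < sg.
  rewrite /sg invfM mulrC [spread%:R / _]mulrC invfM -mulrA ltr_pM2l ?invr_gt0//.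
  rewrite mulrC -[ltLHS]mul1r ltr_pdivrMr// mulrAC ltr_pdivlMr// mul1r.
  by rewrite -natrM ltr_nat.
have pxs : `|x - rpoint p q| < sg := lt_trans px qsg.
exists p, q; split; last first.
  move=> b bL; have /= := xL (b.1, b.2 + sg).
  rewrite mem_cat map_f ?orbT// => /(_ isT).
  by have := ler_distD (rpoint p q) x b.1; lra.
split; first by rewrite q1 qN.
- exact: Nq.
- by have := ler_distD x (rpoint p q) x0; rewrite (distrC _ x); lra.
- move=> p' q' /andP[q'0 q'q] pp'.
  suff : (q <= q')%N by rewrite leqNgt q'q.
  apply: qmin; apply/asboolP; split; first by rewrite q'0 (leq_trans (ltnW q'q)).
  exists p'; rewrite pp'; apply: lt_trans px _.
  by rewrite ltf_pV2 ?posrE ?mulr_gt0 ?ltr0n// ltr_pM2r// ltr_nat.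
- move=> p' q' /andP[Qq' q'q] pp'.
  have q'0 : (0 < q')%N := leq_ltn_trans (leq0n Q) Qq'.
  have psi'0 := psi_gt0 q'0.
  have q'0' : 0 < (q'%:R : R) by rewrite ltr0n.
  (* For small [q'] the Dirichlet part of the gap absorbs the distance from [x] to [p / q]. For
     large [q'] distinct rationals are at least [1 / (q * q')] apart, which the cubic decay of [psi]
     compares with [2 * psi q']. *)
  have [small|large] := leqP (2 * spread * q') N.
    have xq : forall b, b \in L' -> b.2 < `|x - b.1|.
      by move=> b bL; apply: xL; rewrite mem_cat bL.
    have q'N : (0 < q' <= N %/ spread)%N.
      rewrite q'0 leq_divRL ?spread_gt0//; apply: leq_trans small.
      by rewrite mulnC -mulnA leq_pmull.
    have := L'gap x xx0 xq p' q' q'N; rewrite /gap Qq' mul1r.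
    have : sg <= (q'%:R * m%:R)^-1 / 2.
      rewrite /sg ler_pdivlMr// -[leRHS]mul1r ler_pdivlMr ?mulr_gt0//.
      have -> : spread%:R / (m%:R * N%:R) * 2 * (q'%:R * m%:R) =
          (2 * spread * q')%:R / N%:R :> R.
        by rewrite !natrM; field; rewrite !gt_eqF.
      by rewrite ler_pdivrMr// mul1r ler_nat.
    have := ler_distD (rpoint p q) x (rpoint p' q').
    lra.
  have [pq|] := rpoint_eq_or_far (R := R) p p' q1 q'0; first by case: pp'.
  apply: le_trans.
  have Q1q' : (Q1 <= q')%N.
    have : 2 * spread%:R * Q1%:R <= N%:R :> R.
      by apply: le_trans (le_trans Am mN'); rewrite /A; lra.
    rewrite -!natrM ler_nat => QN.
    have : (2 * spread * Q1 < 2 * spread * q')%N := leq_ltn_trans QN large.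
    by rewrite ltn_mul2l => /andP[_ /ltnW].
  have := psi3 _ Q1q'; rewrite -[leRHS]mul1r ler_pdivlMr ?mulr_gt0// => H.
  rewrite -[leRHS]mul1r ler_pdivlMr ?mulr_gt0//.
  have qq' : q%:R <= 2 * spread%:R * q'%:R :> R.
    by rewrite -!natrM ler_nat ltnW// (leq_ltn_trans qN large).
  apply: (@le_trans _ _ (2 * psi q' * (2 * spread%:R * q'%:R * q'%:R))).
    by rewrite ler_wpM2l ?mulr_ge0 ?(ltW psi'0)// ler_wpM2r// ltW.
  apply: le_trans H.
  have -> : 2 * psi q' * (2 * spread%:R * q'%:R * q'%:R) =
     (4 * spread%:R * psi q' * q'%:R ^+ 2) * 1 by ring.
  have -> : q'%:R ^+ 3 * psi q' * (4 * spread%:R) =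
     (4 * spread%:R * psi q' * q'%:R ^+ 2) * q'%:R by ring.
  by rewrite ler_wpM2l ?ler1n// !mulr_ge0 ?exprn_ge0// ltW.
Qed.

End selection.

(** * One step of the nested construction *)

Section child.
Context {R : realType} (d : nat) (psi : nat -> R).
Context (d_ge1 : (1 <= d)%N)
  (psi_gt0 : forall q : nat, (1 <= q)%N -> 0 < psi q)
  (psi_nincr : forall q r : nat, (1 <= q)%N -> (q <= r)%N -> psi r <= psi q).

(** The child lies in the shell where the distance to [p / q] is between [1 - 3 * eps / 4] and
    [1 - eps / 4] times [psi q]. *)
Definition child_center (eps : R) (p : 'rV[int]_d) q : 'rV[R]_d :=
  rpoint p q + const_mx ((1 - eps / 2) * psi q).

Definition child_radius (eps : R) q := eps / 4 * psi q.

(** Up to this denominator [1 / (q * q') >= 2 * psi q], so distinct rationals cannot interfere with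
    the child. *)
Definition child_level q := Num.truncn (2 * q%:R * psi q)^-1.

(** Three cases for [p' / q']. If it equals [p / q], then [q <= q'] and the inner edge of the shell
    gives the bound. If it differs and [q' <= q], the separation [2 * psi q'] suffices; if [q' > q],
    the definition of [child_level] does. *)
Lemma child_exact (eps : R) (Q q : nat) (p : 'rV[int]_d) (x : 'rV[R]_d) :
  0 < eps <= 1 -> (0 < q)%N ->
  (forall p' q', (0 < q' < q)%N -> rpoint p' q' <> rpoint p q :> 'rV[R]_d) ->
  (forall p' q', (Q < q' <= q)%N -> rpoint p' q' <> rpoint p q :> 'rV[R]_d ->
         2 * psi q' <= `|rpoint p q - rpoint p' q'|) ->
  `|x - child_center eps p q| <= child_radius eps q ->
  `|x - rpoint p q| < psi q /\
  forall p' q', (Q < q' <= child_level q)%N ->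
    (1 - eps) * psi q' <= `|x - rpoint p' q'|.
Proof.
move=> /andP[eps0 eps1] q0 qmin qsep xz; have p0 := psi_gt0 q0.
have q0' : 0 < (q%:R : R) by rewrite ltr0n.
have ep0 : 0 < eps * psi q by rewrite mulr_gt0.
have c0 : 0 <= (1 - eps / 2) * psi q by rewrite mulr_ge0 ?(ltW p0)//; lra.
have xi i : `|x ord0 i - rpoint p q ord0 i - (1 - eps / 2) * psi q| <= eps / 4 * psi q.
  apply: le_trans xz; apply: le_trans (rv_norm_coord _ i).
  by rewrite !mxE opprD addrA.
have xp : `|x - rpoint p q| < psi q.
  apply: rv_norm_lt => // i; rewrite rv_subE.
  have := xi i; rewrite ler_norml ltr_norml => /andP[u1 u2]; apply/andP; split; lra.
have px : (1 - eps) * psi q <= `|x - rpoint p q|.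
  apply: le_trans (rv_norm_coord _ (Ordinal d_ge1)); rewrite rv_subE.
  have := xi (Ordinal d_ge1); rewrite ler_norml => /andP[u1 u2].
  by rewrite ler_normr; apply/orP; left; lra.
split=> // p' q' /andP[Qq' q'Q]; have q'0 : (0 < q')%N by lia.
have p'0 := psi_gt0 q'0.
have [pp'|pp'] := pselect (rpoint p' q' = rpoint p q :> 'rV[R]_d).
  have qq' : (q <= q')%N.
    by rewrite leqNgt; apply/negP => q'q; apply: (qmin p' q') => //; rewrite q'0.
  rewrite pp'; apply: le_trans px.
  by rewrite ler_wpM2l ?psi_nincr// subr_ge0.
have tri := ler_distD x (rpoint p q) (rpoint p' q').
rewrite (distrC _ x) in tri.
have ep'0 : 0 < eps * psi q' by rewrite mulr_gt0.
have [q'q|qq'] := leqP q' q.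
  have := qsep p' q'; rewrite Qq' q'q => /(_ isT pp').
  have := psi_nincr q'0 q'q; lra.
have := psi_nincr q0 (ltnW qq').
have [pq|far] := rpoint_eq_or_far (R := R) p p' q0 q'0; first by case: pp'.
suff : 2 * psi q <= (q%:R * q'%:R)^-1 by lra.
rewrite -[leRHS]mul1r ler_pdivlMr ?mulr_gt0 ?ltr0n//.
have qp0 : 0 < 2 * q%:R * psi q by rewrite !mulr_gt0.
move: q'Q; rewrite truncn_ge_nat ?invr_ge0 ?(ltW qp0)//.
by rewrite -[X in _ <= X]mul1r ler_pdivlMr//; lra.
Qed.

Context (psi_sum :
  (\sum_(1 <= q <oo) (q%:R ^+ (3 * d) * psi q ^+ d)%:E < +oo)%E).

(* For [q' > child_level q >= q] one has [1 <= 2 * psi q * q' ^ 2], hence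
   [child_radius q * q' + 1 <= (1 + 8 / eps) * child_radius q * q' ^ 3], and the
   convergence of the series of [q' ^ (3 d) * psi q' ^ d] applies. *)
Lemma psi_vol_tail (eps : R) : 0 < eps -> exists K, forall q, (K <= q)%N ->
  (q <= child_level q)%N /\
  forall N, \sum_((child_level q).+1 <= q' < N)
      ((child_radius eps q * q'%:R + 1) ^+ d * psi q' ^+ d)
    <= vol_const d * child_radius eps q ^+ d.
Proof.
move=> eps0.
have [K1 K10 psi3] := psi_cubic_decay d_ge1 psi_gt0 psi_sum
  (ltac:(lra) : 0 < 2^-1 :> R).
pose c := 1 + 8 / eps : R.
have c0 : 0 < c by rewrite addr_gt0// divr_gt0.
have tail0 : 0 < vol_const d / c ^+ d :> R by rewrite divr_gt0 ?vol_const_gt0 ?exprn_gt0.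
have [K2 K20 tail] := psi_tail psi_gt0 psi_sum tail0.
exists (maxn K1 K2) => q; rewrite geq_max => /andP[K1q K2q].
have q0 : (0 < q)%N := leq_trans K10 K1q.
have p0 := psi_gt0 q0.
have q0' : 0 < (q%:R : R) by rewrite ltr0n.
have q1 : 1 <= (q%:R : R) by rewrite ler1n.
have qp0 : 0 < 2 * q%:R * psi q by rewrite !mulr_gt0.
have /andP[Q1 Q2] : (child_level q)%:R <= (2 * q%:R * psi q)^-1 < (child_level q).+1%:R.
  by apply: truncn_itv; rewrite invr_ge0 ltW.
have qQ : (q <= child_level q)%N.
  rewrite truncn_ge_nat ?invr_ge0 ?(ltW qp0)//.
  rewrite -[leRHS]mul1r ler_pdivlMr//.
  have := psi3 _ K1q; rewrite !exprS expr0 => H.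
  have : q%:R * (q%:R * psi q) <= q%:R * (q%:R * (q%:R * psi q)).
    by rewrite !ler_pM2l// ler_peMl// ltW.
  by lra.
split=> // N; set rho' := child_radius eps q.
have rho'0 : 0 < rho' by rewrite mulr_gt0// divr_gt0.
apply: (@le_trans _ _ ((c * rho') ^+ d *
    \sum_((child_level q).+1 <= q' < N) (q'%:R ^+ (3 * d) * psi q' ^+ d))).
  rewrite mulr_sumr; apply: ler_sum_nat => q' /andP[Qq' _].
  have q'0 : (0 < q')%N := leq_ltn_trans (leq0n _) Qq'.
  have q'1 : 1 <= (q'%:R : R) by rewrite ler1n.
  rewrite mulrA ler_wpM2r ?exprn_ge0 ?(ltW (psi_gt0 _))// exprM -exprMn.
  have hL : 0 <= rho' * q'%:R + 1 by rewrite addr_ge0// mulr_ge0// ltW.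
  have hR : 0 <= c * rho' * q'%:R ^+ 3.
    by apply: mulr_ge0; [apply: mulr_ge0; exact: ltW|exact: exprn_ge0].
  rewrite lerXn2r ?nnegrE//.
  have h1 : 1 <= 8 / eps * rho' * q'%:R ^+ 3.
    have -> : 8 / eps * rho' * q'%:R ^+ 3 = (2 * psi q * q'%:R * q'%:R) * q'%:R.
      by rewrite /rho' /child_radius; field; rewrite gt_eqF.
    apply: (@le_trans _ _ (2 * q%:R * psi q * q'%:R)).
      rewrite -ler_pdivrMl// mulr1; apply: le_trans (ltW Q2) _.
      by rewrite ler_nat.
    apply: (@le_trans _ _ (2 * psi q * q'%:R * q'%:R)).
      have -> : 2 * q%:R * psi q * q'%:R = 2 * psi q * q'%:R * q%:R by ring.
      by rewrite ler_wpM2l ?mulr_ge0 ?(ltW p0)// ler_nat (leq_trans qQ (ltnW Qq')).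
    by rewrite ler_peMr// !mulr_ge0// ltW.
  have h2 : rho' * q'%:R <= rho' * q'%:R ^+ 3.
    rewrite ler_pM2l// exprS ler_peMr// exprn_ege1//.
  by rewrite /c; lra.
rewrite exprMn mulrAC ler_wpM2r ?exprn_ge0 ?(ltW rho'0)//.
rewrite mulrC -ler_pdivlMr ?exprn_gt0//; apply: tail.
exact: leq_trans K2q (leq_trans qQ (leqnSn _)).
Qed.

End child.

(** Stage [k] adds [n k] entries, each of cost [u] at most [delta k] and of gain [wt] at least
    [w k]. The costs stay within the budget [V], and as the earlier stages hold at most [n k]
    entries altogether, the size never exceeds [2 * n k], so the one-step hypothesis keeps
    applying. *)
Lemma greedy_exhaustion {R : realType} (T : Type) (good : seq T -> Prop)
    (u wt : T -> R) (n : nat -> nat) (delta w : nat -> R) (V : R) (k0 : nat) :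
  good [::] -> (forall k, 0 <= delta k) ->
  (forall k, \sum_(k0 <= j < k) (n j)%:R * delta j <= V) ->
  (forall k, (k0 <= k)%N -> \sum_(k0 <= j < k) n j <= n k)%N ->
  (forall k F, (k0 <= k)%N -> good F -> (size F <= 2 * n k)%N ->
    \sum_(C <- F) u C <= V ->
    exists C, [/\ good (C :: F), u C <= delta k & w k <= wt C]) ->
  forall K, exists F, good F /\
    \sum_(k0 <= j < K) (n j)%:R * w j <= \sum_(C <- F) wt C.
Proof.
move=> good0 delta0 deltaV nn one K.
suff [F [gF _ _ wF]] : exists F, [/\ good F,
    size F = (\sum_(k0 <= j < K) n j)%N,
    \sum_(C <- F) u C <= \sum_(k0 <= j < K) (n j)%:R * delta j &
    \sum_(k0 <= j < K) (n j)%:R * w j <= \sum_(C <- F) wt C] by exists F.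
elim: K => [|K [F [gF sF uF wF]]].
  by exists [::]; rewrite !big_geq// !big_nil.
have [k0K|Kk0] := leqP k0 K; last first.
  by exists F; rewrite !(@big_geq _ _ _ _ K.+1)// in sF uF wF *;
     rewrite !big_geq// in sF uF wF; lia.
rewrite !big_nat_recr//=.
suff : forall i, (i <= n K)%N -> exists F', [/\ good F',
    size F' = (\sum_(k0 <= j < K) n j + i)%N,
    \sum_(C <- F') u C <= \sum_(k0 <= j < K) (n j)%:R * delta j + i%:R * delta K &
    \sum_(k0 <= j < K) (n j)%:R * w j + i%:R * w K <= \sum_(C <- F') wt C].
  by move/(_ _ (leqnn _)).
elim=> [_|i IH iK]; first by exists F; rewrite addn0 !mul0r !addr0.
have [F' [gF' sF' uF' wF']] := IH (ltnW iK).
have [|| C [gC uC wC]] := one K F' k0K gF'.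
- by rewrite sF'; have := nn _ k0K; lia.
- apply: le_trans uF' _; apply: le_trans (deltaV K.+1).
  by rewrite big_nat_recr//= lerD2l ler_wpM2r// ler_nat ltnW.
exists (C :: F'); split=> //=; first by rewrite sF' addnS.
- by rewrite big_cons -natr1 mulrDl mul1r; lra.
- by rewrite big_cons -natr1 mulrDl mul1r; lra.
Qed.

Section greedy_parameters.
Context {R : realType}.

Lemma geometric_half_sum k0 k : \sum_(k0 <= j < k) (2 ^+ j)^-1 <= 2 :> R.
Proof.
have H n : \sum_(0 <= j < n) (2 ^+ j)^-1 = 2 - 2 * (2 ^+ n)^-1 :> R.
  elim: n => [|n IH]; first by rewrite big_geq// expr0 invr1 mulr1 subrr.
  by rewrite big_nat_recr//= IH exprS invfM; field; rewrite expf_neq0.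
have [kk0|k0k] := leqP k k0; first by rewrite big_geq.
have : \sum_(k0 <= j < k) (2 ^+ j)^-1 <= \sum_(0 <= j < k) (2 ^+ j)^-1 :> R.
  rewrite [leRHS](big_cat_nat (n := k0))/=; [|by []|exact: ltnW].
  by rewrite lerDr sumr_ge0// => j _; rewrite invr_ge0 exprn_ge0.
have : 0 <= (2 ^+ k)^-1 :> R by rewrite invr_ge0 exprn_ge0.
rewrite H; lra.
Qed.

(** Each term is at least twice the preceding one; [e <= k0] keeps the subtraction in the exponent
    from truncating. *)
Lemma sum_powers_of_two_le D e k0 : (0 < D)%N -> (e <= k0)%N ->
  forall k, (k0 <= k)%N ->
    (\sum_(k0 <= j < k) 2 ^ (j * D - e) <= 2 ^ (k * D - e))%N.
Proof.
move=> D0 ek0; elim=> [|k IH]; first by rewrite leqn0 => /eqP->; rewrite big_geq.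
rewrite leq_eqVlt => /predU1P[<-|k0k]; first by rewrite big_geq.
rewrite big_nat_recr//=.
apply: (@leq_trans (2 ^ (k * D - e) + 2 ^ (k * D - e))).
  by rewrite leq_add2r IH.
rewrite addnn -mul2n -expnS leq_exp2l// mulSn.
have : (e <= k * D)%N by rewrite (leq_trans (leq_trans ek0 k0k))// leq_pmulr.
by clear -D0; lia.
Qed.

End greedy_parameters.

(** * Existence of a light child *)

Section step.
Context {R : realType} (d : nat) (psi : nat -> R).
Context (d_ge1 : (1 <= d)%N)
  (psi_gt0 : forall q : nat, (1 <= q)%N -> 0 < psi q)
  (psi_nincr : forall q r : nat, (1 <= q)%N -> (q <= r)%N -> psi r <= psi q)
  (psi_sum : (\sum_(1 <= q <oo) (q%:R ^+ (3 * d) * psi q ^+ d)%:E < +oo)%E).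
Context (s : R) (s_itv : 0 < s < d%:R).
Context (I : set nat) (a : nat -> 'rV[R]_d) (r : nat -> R) (M : R).
Context (r_gt0 : forall i, I i -> 0 < r i)
  (r_sum : forall U : seq nat, uniq U -> (forall i, i \in U -> I i) ->
     \sum_(i <- U) r i `^ s <= M).

Definition meets (x0 : 'rV[R]_d) (rho : R) i := I i /\ `|a i - x0| < r i + rho.

(** A third for each of the three contributions in [forbidden_volume], and [8 ^+ d] for the
    constants lost there. *)
Definition light_const : R := vol_const d / (3 * 8 ^+ d).

(** Bounding all finite subfamilies stands for bounding the possibly infinite sum over the balls
    met. *)
Definition light (x0 : 'rV[R]_d) (rho : R) :=
  forall U : seq nat, uniq U -> (forall i, i \in U -> meets x0 rho i) ->
    \sum_(i <- U) r i ^+ d <= light_const * rho ^+ d.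

Lemma light_const_gt0 : 0 < light_const.
Proof. by rewrite divr_gt0 ?vol_const_gt0// mulr_gt0 ?exprn_gt0. Qed.

Lemma light_const_le1 : light_const <= 1.
Proof.
have one_le (x : R) : 1 <= x -> 1 <= x ^+ d by exact: exprn_ege1.
rewrite /light_const /vol_const -invfM invf_le1; last first.
  by rewrite !mulr_gt0// exprn_gt0// !mulr_gt0.
have : 1 <= (8 : R) ^+ d by apply: one_le; lra.
have : 1 <= (2 * 4 * 4 * 6 : R) ^+ d by apply: one_le; lra.
set x := _ ^+ d; set y := _ ^+ d => x1 y1.
have : 1 * 1 <= x * y by rewrite ler_pM.
lra.
Qed.

(** By contraposition: a small sum of [r i ^ s] forces every [r i <= rho], as [light_const <= 1],
    and then [r i ^ d <= r i ^ s * rho ^ (d - s)]. *)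
Lemma sum_powR_lower (rho : R) (U : seq nat) : 0 < rho ->
  (forall i, i \in U -> I i) ->
  light_const * rho ^+ d < \sum_(i <- U) r i ^+ d ->
  light_const * rho `^ s < \sum_(i <- U) r i `^ s.
Proof.
move=> rho0 UI; apply: contraTT; rewrite -!leNgt => sU.
have /andP[s0 sd] := s_itv.
have c0 := light_const_gt0.
have r_le i : i \in U -> r i <= rho.
  move=> iU; rewrite leNgt; apply/negP => rhor.
  have : rho `^ s < r i `^ s.
    by rewrite gt0_ltr_powR ?nnegrE ?(ltW rho0)// ltW// (lt_trans rho0).
  apply/negP; rewrite -leNgt.
  apply: (@le_trans _ _ (light_const * rho `^ s)); last first.
    by rewrite ler_piMl ?powR_ge0// light_const_le1.
  apply: le_trans sU; rewrite (big_rem i)//= lerDl sumr_ge0// => j _.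
  exact: powR_ge0.
have split_pow (x : R) : 0 < x -> x ^+ d = x `^ s * x `^ (d%:R - s).
  move=> x_gt0; rewrite -powRD; last by rewrite (gt_eqF x_gt0) implybT.
  by rewrite addrC subrK powR_mulrn// ltW.
apply: (@le_trans _ _ (\sum_(i <- U) r i `^ s * rho `^ (d%:R - s))).
  rewrite big_seq [leRHS]big_seq; apply: ler_sum => i iU.
  have ri0 := r_gt0 (UI _ iU).
  rewrite split_pow// ler_wpM2l ?powR_ge0//.
  by rewrite ge0_ler_powR ?nnegrE ?(ltW ri0) ?(ltW rho0) ?r_le//; lra.
by rewrite -mulr_suml (split_pow rho)// mulrA ler_wpM2r ?powR_ge0.
Qed.

Definition max_radius (J : seq nat) := \big[Num.max/0]_(i <- J) r i.

Lemma le_max_radius J i : i \in J -> r i <= max_radius J.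
Proof.
elim: J => // j J IH; rewrite inE /max_radius big_cons le_max.
by move=> /predU1P[->|/IH H]; rewrite ?lexx// [X in _ || X]H orbT.
Qed.

Lemma max_radius_ge0 J : 0 <= max_radius J.
Proof.
elim: J => [|j J IH]; first by rewrite /max_radius big_nil.
by rewrite /max_radius big_cons le_max [X in _ || X]IH orbT.
Qed.

Lemma max_radius_expr J : (forall i, i \in J -> I i) ->
  max_radius J ^+ d <= \sum_(i <- J) r i ^+ d.
Proof.
elim: J => [_|j J IH JI].
  by rewrite /max_radius !big_nil expr0n; case: (d) d_ge1.
have rj0 := r_gt0 (JI j (mem_head _ _)).
have JI' i : i \in J -> I i by move=> iJ; apply: JI; rewrite inE iJ orbT.
rewrite /max_radius !big_cons -/(max_radius J).
have [_|_] := leP (r j) (max_radius J).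
  by apply: le_trans (IH JI') _; rewrite lerDr exprn_ge0// ltW.
rewrite lerDl big_seq sumr_ge0// => i /JI'/r_gt0/ltW ri0.
exact: exprn_ge0.
Qed.

Variables (x0 : 'rV[R]_d) (rho : R) (Q : nat) (eps : R).
Hypotheses (rho01 : 0 < rho <= 1) (eps01 : 0 < eps <= 1)
  (psi_vol : forall N, \sum_(Q.+1 <= q < N) ((rho * q%:R + 1) ^+ d * psi q ^+ d)
     <= vol_const d * rho ^+ d)
  (light_x0 : light x0 rho).

(* An entry [(c, u, J)] records a rational [c], picked with [u = psi q], whose
   child is hit by the balls [J]. *)
Let entry := ('rV[R]_d * R * seq nat)%type.
Let hits (F : seq entry) := flatten [seq C.2 | C <- F].

(** Uniqueness in the concatenation makes the families of distinct entries disjoint, so that their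
    sums of [r i ^ s] add up to at most [M]. *)
Definition good (F : seq ('rV[R]_d * R * seq nat)) := uniq (hits F) /\
  forall C, C \in F -> 0 <= C.1.2 /\
    forall i, i \in C.2 -> meets x0 rho i /\ `|a i - C.1.1| <= r i + 2 * C.1.2.

Let V := light_const * rho ^+ d.

(** The radii, the values [u] and [sg] contribute at most [V] each; for the radii this is the
    lightness of the parent ball, applied to the disjoint union of the families. *)
Lemma forbidden_volume F sg : good F -> 0 <= sg ->
  \sum_(C <- F) C.1.2 ^+ d <= V -> (size F)%:R * sg ^+ d <= V ->
  \sum_(C <- F) (2 * max_radius C.2 + 2 * C.1.2 + sg + sg) ^+ d
    <= vol_const d * rho ^+ d.
Proof.
move=> [uF gF] sg0 uV sgV.
have -> : vol_const d * rho ^+ d = 8 ^+ d * (V + (V + V)).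
  rewrite /V /light_const; field.
  by rewrite expf_neq0.
have RV : \sum_(C <- F) max_radius C.2 ^+ d <= V.
  apply: le_trans (light_x0 uF _); last first.
    move=> i /flattenP[J /mapP[C CF ->] iJ].
    by have [_ H] := gF _ CF; have [] := H _ iJ.
  rewrite /hits big_flatten big_map/= big_seq [leRHS]big_seq.
  apply: ler_sum => C CF; apply: max_radius_expr => i iJ.
  by have [_ H] := gF _ CF; have [[]] := H _ iJ.
apply: (@le_trans _ _ (\sum_(C <- F)
   8 ^+ d * (max_radius C.2 ^+ d + (C.1.2 ^+ d + sg ^+ d)))).
  rewrite big_seq [leRHS]big_seq; apply: ler_sum => C CF.
  have [u0 _] := gF _ CF; have R0 := max_radius_ge0 C.2.
  set x := max_radius _ in R0 *; set u := C.1.2 in u0 *.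
  have -> : 2 * x + 2 * u + sg + sg = 2 * (x + (u + sg)) by ring.
  have -> : (8 : R) = 2 * (2 * 2) by ring.
  rewrite !exprMn -[leRHS]mulrA ler_wpM2l ?exprn_ge0//.
  apply: le_trans (expr_add_le _ R0 (addr_ge0 u0 sg0)) _.
  rewrite -[leRHS]mulrA ler_wpM2l ?exprn_ge0// mulrDr lerD//.
    by rewrite ler_peMl ?exprn_ge0// exprn_ege1//; lra.
  exact: expr_add_le.
rewrite -mulr_sumr ler_wpM2l ?exprn_ge0// !big_split/=.
by rewrite !lerD// big_const_seq count_predT iter_addr_0 -[leLHS]mulr_natl.
Qed.

(** Every point of the child is settled for the denominators in [(Q, Q']]; the volume bound above
    [Q'] and lightness allow the construction to continue. *)
Definition has_light_child := exists (z : 'rV[R]_d) rho' Q' (p : 'rV[int]_d) q,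
  [/\ 0 < rho' <= rho / 2, `|z - x0| + rho' <= rho, light z rho',
    (forall N, \sum_(Q'.+1 <= q < N) ((rho' * q%:R + 1) ^+ d * psi q ^+ d)
     <= vol_const d * rho' ^+ d) &
    (Q < q <= Q')%N /\ forall x, `|x - z| <= rho' -> `|x - rpoint p q| < psi q /\
      forall p' q', (Q < q' <= Q')%N -> (1 - eps) * psi q' <= `|x - rpoint p' q'|].

(* If no child is light, each pick is hit by balls of substantial total size;
   keeping away from these balls makes the sets of balls met by different
   picks disjoint. *)
Lemma extend_good : ~ has_light_child -> exists k1, forall k F, (k1 <= k)%N ->
  let m := (2 ^ k)%N in let N := (m ^ d)%N in
  let sg := (spread d)%:R / (m%:R * N%:R) : R in
  good F -> (size F)%:R * sg ^+ d <= V -> \sum_(C <- F) C.1.2 ^+ d <= V ->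
  exists C, [/\ good (C :: F), C.1.2 ^+ d <= sg ^+ d / 2 ^+ k &
    light_const * (eps / 4) `^ s * psi N `^ s <= \sum_(i <- C.2) r i `^ s].
Proof.
move=> nochild.
have /andP[rho0 rho1] := rho01; have /andP[eps0 eps1] := eps01.
have /andP[s0 sd] := s_itv.
have b0 : 0 < ((spread d)%:R : R) by rewrite ltr0n spread_gt0.
have b1 : 1 <= ((spread d)%:R : R) by rewrite ler1n spread_gt0.
have [k1 pick] := pick_rational d_ge1 psi_gt0 x0 rho01 psi_vol psi_sum.
have [K psiK] := psi_vol_tail d_ge1 psi_gt0 psi_sum eps0.
have e10 : 0 < rho / 8 / (spread d)%:R ^+ 2 :> R.
  by rewrite !divr_gt0// exprn_gt0.
have [K2 K20 psi3] := psi_cubic_decay d_ge1 psi_gt0 psi_sum e10.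
(* Since [spread * q > N > k], this threshold makes the picked denominator exceed [K], [K2] and
   [Q]. *)
exists (k1 + spread d * (K + K2 + Q) + 1)%N => k F kk m N sg gF sgV uV.
have k1k : (k1 <= k)%N by apply: leq_trans kk; rewrite -addnA leq_addr.
have k_gt0 : (0 < k)%N by apply: leq_trans kk; rewrite addn1.
have kN : (k < N)%N.
  by apply: leq_trans (ltn_expl k (ltnSn 1)) _; rewrite -[leqLHS]expn1 leq_pexp2l// expn_gt0.
have sKN : (spread d * (K + K2 + Q) < N)%N.
  apply: leq_ltn_trans kN; apply: leq_trans kk.
  by rewrite -(addnA k1) (addnCA k1) leq_addr.
have mm2 : 2 <= (m%:R : R) by rewrite ler_nat -[leqLHS]expn1 leq_pexp2l.
have m0' : 0 < (m%:R : R) by lra.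
have mN : (m%:R : R) <= N%:R.
  by rewrite ler_nat -[leqLHS]expn1 leq_pexp2l// expn_gt0.
have md : (2 ^+ k : R) <= m%:R ^+ d.
  by rewrite -!natrX ler_nat -[leqLHS]expn1 leq_pexp2l// expn_gt0.
have N0' : 0 < (N%:R : R) by lra.
have sg0 : 0 < sg by rewrite divr_gt0// mulr_gt0.
(* A ball [i] hitting both an old and the new child has its centre within [r i + 2 * C.1.2] and
   [r i + 2 * psi q] of the two rationals. As [2 * psi q <= sg], a new rational outside these balls
   has a disjoint family. *)
pose L := [seq (C.1.1, 2 * max_radius C.2 + 2 * C.1.2 + sg) | C <- F].
have L0 b : b \in L -> 0 <= b.2.
  move=> /mapP[C CF ->] /=; have [u0 _] := gF.2 _ CF.
  by have := max_radius_ge0 C.2; lra.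
have Lvol : \sum_(b <- L) (b.2 + sg) ^+ d <= vol_const d * rho ^+ d.
  by rewrite big_map/=; apply: forbidden_volume => //; exact: ltW.
have [p [q [[/andP[q0 qN] Nq pqx0 qmin qsep] pqL]]] := pick k k1k L L0 Lvol.
have KKq : (K + K2 + Q < q)%N.
  by rewrite -(@ltn_pmul2l (spread d)) ?spread_gt0//; exact: ltn_trans sKN Nq.
have Kq : (K <= q)%N by apply: leq_trans (ltnW KKq); rewrite -addnA leq_addr.
have K2q : (K2 <= q)%N by apply: leq_trans (ltnW KKq); rewrite addnAC leq_addl.
have Qq : (Q < q)%N by apply: leq_ltn_trans KKq; rewrite leq_addl.
clear kk sKN KKq pick kN.
have q0' : 0 < (q%:R : R) by rewrite ltr0n.
have q1' : 1 <= (q%:R : R) by rewrite ler1n.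
have p0 := psi_gt0 q0.
have psi3q := psi3 _ K2q.
have psiq : psi q <= rho / 8.
  apply: (@le_trans _ _ (q%:R ^+ 3 * psi q)).
    by rewrite ler_peMl ?(ltW p0)// exprn_ege1.
  apply: le_trans psi3q _; rewrite ler_pdivrMr ?exprn_gt0// ler_peMr//.
    by rewrite divr_ge0 ?(ltW rho0).
  exact: exprn_ege1.
(* The extra factor [m] yields the [2 ^- k] in the cost of an entry, which makes the costs summable
   over the stages. *)
have psisg : psi q * m%:R <= sg.
  rewrite /sg ler_pdivlMr ?mulr_gt0//.
  apply: (@le_trans _ _ (psi q * (spread d)%:R ^+ 3 * q%:R ^+ 3)).
    have Nq' : (N%:R : R) <= (spread d)%:R * q%:R by rewrite -natrM ler_nat ltnW.
    have -> : psi q * m%:R * (m%:R * N%:R) = psi q * (m%:R * m%:R * N%:R) by ring.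
    have -> : psi q * (spread d)%:R ^+ 3 * q%:R ^+ 3 = psi q *
      ((spread d)%:R * q%:R * ((spread d)%:R * q%:R) * ((spread d)%:R * q%:R)) by ring.
    have mq := le_trans mN Nq'.
    by rewrite ler_pM2l// !ler_pM ?mulr_ge0 ?(ltW m0') ?(ltW N0').
  have : (spread d)%:R ^+ 3 * (q%:R ^+ 3 * psi q) <=
      (spread d)%:R ^+ 3 * (rho / 8 / (spread d)%:R ^+ 2).
    by rewrite ler_wpM2l ?exprn_ge0// ltW.
  have -> : (spread d)%:R ^+ 3 * (rho / 8 / (spread d)%:R ^+ 2) =
      (spread d)%:R * (rho / 8) :> R by field; rewrite gt_eqF.
  have -> : (spread d)%:R ^+ 3 * (q%:R ^+ 3 * psi q) =
     psi q * (spread d)%:R ^+ 3 * q%:R ^+ 3 by ring.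
  move=> /le_trans; apply; rewrite ler_piMr ?(ltW b0)//; lra.
have psi2 : 2 * psi q <= sg.
  by apply: le_trans psisg; rewrite mulrC ler_pM2l.
pose z := child_center psi eps p q; pose rho' := child_radius psi eps q.
have [qQ' vol'] := psiK _ Kq.
have rho'0 : 0 < rho' by rewrite mulr_gt0// divr_gt0.
have rho'psi : rho' <= psi q.
  by rewrite /rho' /child_radius ler_piMl ?(ltW p0)//; lra.
have zp : `|z - rpoint p q| <= psi q.
  apply: rv_norm_le => [|i]; first exact: ltW.
  rewrite /z /child_center addrC addKr mxE ger0_norm.
    by rewrite ler_piMl ?(ltW p0)//; lra.
  by rewrite mulr_ge0 ?(ltW p0)//; lra.
have zx0 : `|z - x0| + rho' <= rho.
  by have := ler_distD (rpoint p q) z x0; lra.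
have nlight : ~ light z rho'.
  move=> lz; apply: nochild.
  exists z, rho', (child_level psi q), p, q; split=> //.
  - by rewrite rho'0/=; lra.
  - rewrite Qq qQ'; split=> // x xz.
    exact: (child_exact d_ge1 psi_gt0 psi_nincr eps01 q0 qmin qsep xz).
have [J [uJ Jz Jbig]] : exists J : seq nat, [/\ uniq J,
    forall i, i \in J -> meets z rho' i &
    light_const * rho' ^+ d < \sum_(i <- J) r i ^+ d].
  apply: contrapT => /forallNP H; apply: nlight => U uU Uz.
  by rewrite leNgt; apply/negP => lU; apply: (H U); split.
exists (rpoint p q, psi q, J) => /=; split; last first.
- have := sum_powR_lower rho'0 (fun i iJ => (Jz i iJ).1) Jbig => /ltW.
  apply: le_trans; rewrite -mulrA ler_wpM2l ?(ltW light_const_gt0)//.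
  rewrite /rho' /child_radius [leRHS]powRM ?(ltW p0) ?divr_ge0 ?(ltW eps0)//.
  rewrite ler_wpM2l ?powR_ge0// ge0_ler_powR ?nnegrE ?(ltW s0) ?(ltW p0)//.
    by rewrite ltW// psi_gt0// (leq_trans q0).
  exact: psi_nincr.
- rewrite ler_pdivlMr ?exprn_gt0//.
  apply: (@le_trans _ _ (psi q ^+ d * m%:R ^+ d)).
    by rewrite ler_wpM2l ?exprn_ge0// ltW.
  by rewrite -exprMn lerXn2r ?nnegrE ?mulr_ge0 ?(ltW p0) ?(ltW sg0).
have Jp i : i \in J -> meets x0 rho i /\ `|a i - rpoint p q| <= r i + 2 * psi q.
  move=> /Jz [Ii ai]; split; first split=> //.
    by have := ler_distD z (a i) x0; lra.
  by have := ler_distD z (a i) (rpoint p q); lra.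
split; last first.
  move=> C; rewrite inE => /predU1P[->/=|CF]; last exact: gF.2.
  by split=> //; exact: ltW.
rewrite /hits /= cat_uniq uJ gF.1 andbT /=.
apply/hasPn => i /flattenP[J' /mapP[C CF ->] iC]; apply/negP => /= iJ.
have [_ aip] := Jp _ iJ.
have [u0 /(_ _ iC) [_ aiC]] := gF.2 _ CF.
have riC := le_max_radius iC.
have /= := pqL (C.1.1, 2 * max_radius C.2 + 2 * C.1.2 + sg) (map_f _ CF).
have := ler_distD (a i) (rpoint p q) C.1.1.
rewrite (distrC (rpoint p q) (a i)); lra.
Qed.

Hypothesis divergence : forall k0 B, exists K,
  B < \sum_(k0 <= k < K) (((2 ^ d) ^ k)%N%:R ^+ d.+1 * psi ((2 ^ d) ^ k)%N `^ s).

(** Otherwise the greedy selection makes about [N ^ (d + 1)] picks at each stage, [N = 2 ^ (d * k)],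
    and their disjoint families have a total sum of [r i ^ s] that diverges with the condensed
    series, against the bound [M]. *)
Lemma light_child : has_light_child.
Proof.
apply: contrapT => nochild.
have /andP[rho0 rho1] := rho01; have /andP[eps0 eps1] := eps01.
have [k1 extend] := extend_good nochild.
have V0 : 0 < V by rewrite mulr_gt0 ?light_const_gt0// exprn_gt0.
have b0 : 0 < ((spread d)%:R ^+ d : R) by rewrite exprn_gt0// ltr0n spread_gt0.
(* [e] is large enough for both budgets: [2 * n k] gaps [sg ^+ d], and the total cost of all the
   stages, are each at most [2 * spread ^ d / 2 ^ e <= V]. *)
pose e := (Num.truncn (2 * (spread d)%:R ^+ d / V : R)).+1.
have eV : 2 * (spread d)%:R ^+ d / 2 ^+ e <= V.
  have : 0 <= 2 * (spread d)%:R ^+ d / V by rewrite ltW// divr_gt0// mulr_gt0.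
  move=> /truncn_itv/andP[_]; rewrite -/e => /ltW H.
  rewrite ler_pdivrMr ?exprn_gt0// [leRHS]mulrC -ler_pdivrMr//.
  by apply: le_trans H _; rewrite -natrX ler_nat ltnW// ltn_expl.
pose D := (d * d.+1)%N.
have D0 : (0 < D)%N by rewrite muln_gt0 d_ge1.
pose k0 := (k1 + e)%N.
(* [2 ^ (k * D)] is [N ^ (d + 1)] and also [(m * N) ^ d], so [n k] picks match the size of
   [sg ^+ d]. *)
pose n k := (2 ^ (k * D - e))%N.
pose delta k : R := (spread d)%:R ^+ d / (2 ^+ (k * D) * 2 ^+ k).
pose w k : R := light_const * (eps / 4) `^ s * psi ((2 ^ k) ^ d)%N `^ s.
have nE k : (k0 <= k)%N -> (n k)%:R = 2 ^+ (k * D) / 2 ^+ e :> R.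
  move=> k0k; have ek : (e <= k * D)%N.
    by apply: leq_trans (leq_trans (leq_addl k1 e) k0k) _; rewrite leq_pmulr.
  by rewrite /n natrX expfB_cond ?pnatr_eq0//; case: ltnP => //; case.
have sgE k : ((spread d)%:R / ((2 ^ k)%N%:R * ((2 ^ k) ^ d)%N%:R)) ^+ d =
    (spread d)%:R ^+ d / 2 ^+ (k * D) :> R.
  rewrite expr_div_n; congr (_ / _).
  by rewrite -natrM -expnS !natrX -!exprM /D; congr (_ ^+ _); ring.
have wt_sum F : good F -> \sum_(C <- F) \sum_(i <- C.2) r i `^ s <= M.
  move=> [uF gF]; apply: le_trans (r_sum uF _).
    by rewrite /hits big_flatten big_map.
  move=> i /flattenP[J /mapP[C CF ->] iJ].
  by have [_ H] := gF _ CF; have [[]] := H _ iJ.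
have exhaust := @greedy_exhaustion R _ good (fun C => C.1.2 ^+ d)
  (fun C => \sum_(i <- C.2) r i `^ s) n delta w V k0.
have {exhaust}exhaust : forall K, exists F, good F /\
    \sum_(k0 <= j < K) (n j)%:R * w j <= \sum_(C <- F) \sum_(i <- C.2) r i `^ s.
  apply: exhaust.
  - by split.
  - by move=> k; rewrite divr_ge0 ?(ltW b0)// mulr_ge0 ?exprn_ge0.
  - move=> k; apply: le_trans eV.
    apply: (@le_trans _ _ (\sum_(k0 <= j < k) (spread d)%:R ^+ d / 2 ^+ e * (2 ^+ j)^-1)).
      apply: ler_sum_nat => j /andP[k0j _]; rewrite nE// /delta.
      by rewrite le_eqVlt; apply/orP; left; apply/eqP; field; rewrite !expf_neq0.
    rewrite -mulr_sumr -[leRHS]mulrA [leRHS]mulrC ler_wpM2l//.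
    exact: geometric_half_sum.
  - by move=> k; apply: sum_powers_of_two_le => //; exact: leq_addl.
  - move=> k F k0k gF sF uF.
    have [||C [gC uC wC]] := extend k F (leq_trans (leq_addr _ _) k0k) gF.
    + rewrite sgE; apply: le_trans eV.
      apply: (@le_trans _ _ ((2 * n k)%N%:R * ((spread d)%:R ^+ d / 2 ^+ (k * D)))).
        by rewrite ler_wpM2r ?divr_ge0 ?(ltW b0) ?exprn_ge0// ler_nat.
      rewrite natrM nE//.
      by rewrite le_eqVlt; apply/orP; left; apply/eqP; field; rewrite !expf_neq0.
    + exact: uF.
    + exists C; split=> //; apply: le_trans uC _.
      by rewrite sgE /delta invfM mulrA.
pose theta : R := light_const * (eps / 4) `^ s / 2 ^+ e.
have theta0 : 0 < theta.
  by rewrite divr_gt0 ?exprn_gt0// mulr_gt0 ?light_const_gt0// powR_gt0// divr_gt0.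
have [K] := divergence k0 (M / theta).
rewrite ltr_pdivrMr// => HK.
have [F [gF]] := exhaust K.
apply/negP; rewrite -ltNge; apply: le_lt_trans (wt_sum _ gF) _.
apply: lt_le_trans HK _; rewrite mulr_suml; apply: ler_sum_nat => j /andP[k0j _].
rewrite nE// /w /theta.
have -> : ((2 ^ d) ^ j = (2 ^ j) ^ d)%N by rewrite -!expnM mulnC.
have -> : ((2 ^ j) ^ d)%N%:R ^+ d.+1 = 2 ^+ (j * D) :> R.
  by rewrite !natrX -!exprM /D mulnA.
by rewrite le_eqVlt; apply/orP; left; apply/eqP; field; rewrite expf_neq0.
Qed.

End step.

(** * The Hausdorff measure *)

Section exact_points.
Context {R : realType} (d : nat) (psi : nat -> R).

Lemma approximants_finite (f : nat -> R) (x : 'rV[R]_d) Q :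
  (forall pq, approximants f x pq -> (pq.2 <= Q)%N) ->
  finite_set (approximants f x).
Proof.
move=> fQ.
(* The sign of [f] is arbitrary here; the absolute value gives [rational_net] a nonnegative
   radius. *)
have ex_net q : exists s : seq 'rV[int]_d, (0 < q)%N ->
    forall p : 'rV_d, `|rpoint p q - x| <= `|f q| -> p \in s.
  have [q0|q0] := posnP q; first by exists [::]; rewrite q0.
  have [s [_ Hs]] := rational_net x q0 (normr_ge0 (f q)).
  by exists s.
have [net netP] := choice ex_net.
apply: (@sub_finite_set _ _ [set` [seq (p, q) | q <- iota 0 Q.+1, p <- net q]]);
  last exact: finite_seq.
move=> [p q] pq; have /= qQ := fQ _ pq; have [/= q0 xpq] := pq.
apply: (_ : (p, q) \in [seq (p, q) | q <- iota 0 Q.+1, p <- net q]).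
apply/allpairsPdep; exists q, p; split=> //; first by rewrite mem_iota.
apply: netP => //; rewrite distrC; apply: le_trans (ltW xpq) _.
exact: ler_norm.
Qed.

(** The intervals [(Q n, Q n.+1]] exhaust the denominators above [Q 0]. Each contains an
    approximation, so there are infinitely many; once [1 / (n + 2) <= e], none is left for
    [(1 - e) * psi]. *)
Lemma exact_of_levels (x : 'rV[R]_d) (Q q : nat -> nat) (p : nat -> 'rV[int]_d) :
  (forall i, (1 <= i)%N -> 0 < psi i) ->
  (forall i, 0 <= x ord0 i <= 1) ->
  (forall n, (Q n < q n <= Q n.+1)%N) ->
  (forall n, `|x - rpoint (p n) (q n)| < psi (q n)) ->
  (forall n p' q', (Q n < q' <= Q n.+1)%N ->
     (1 - n.+2%:R^-1) * psi q' <= `|x - rpoint p' q'|) ->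
  Exact d psi x.
Proof.
move=> psi_gt0 x01 Qq xq xsep.
have Qmono n : (Q n < Q n.+1)%N by have /andP[a b] := Qq n; exact: leq_trans b.
have nQ n : (n <= Q n)%N by elim: n => // n IH; exact: leq_ltn_trans (Qmono n).
split; first split=> //.
  move=> /finite_seqP[s sE].
  pose N := (\max_(pq <- s) pq.2)%N.
  have : (q N <= N)%N.
    have : approximants psi x (p N, q N).
      by split; [have /andP[a _] := Qq N; exact: leq_ltn_trans a|exact: xq].
    by rewrite sE /= => pqs; rewrite /N (leq_bigmax_seq _ pqs).
  have /andP[a _] := Qq N.
  by rewrite leqNgt (leq_ltn_trans (nQ N) a).
move=> [e /= /andP[e0 e1] [_]]; apply.
have ei : 0 <= e^-1 by rewrite invr_ge0 ltW.
pose n0 := Num.truncn e^-1.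
have n0e n : (n0 <= n)%N -> n.+2%:R^-1 <= e.
  move=> n0n; have /andP[_ en] := truncn_itv ei.
  rewrite -[leRHS]invrK lef_pV2 ?posrE ?invr_gt0//.
  by apply: le_trans (ltW en) _; rewrite ler_nat ltnS ltnW.
apply: (approximants_finite (Q := Q n0)) => -[p' q'] [/= q'0 xpq'].
rewrite leqNgt; apply/negP => Qq'.
have exn : exists n, (q' <= Q n)%N by exists q'.
have [n q'Qn nmin] := ex_minnP exn.
have n0n : (n0 < n)%N.
  rewrite ltnNge; apply/negP => nn0.
  have Qle : {homo Q : i j / (i <= j)%N}.
    by apply: homo_leq => //; [exact: leq_trans|move=> i; exact: ltnW].
  by have := leq_trans q'Qn (Qle _ _ nn0); rewrite leqNgt Qq'.
case: n => // n in q'Qn nmin n0n *.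
have Qn : (Q n < q')%N.
  by rewrite ltnNge; apply/negP => /nmin; rewrite ltnn.
have := xsep n p' q'; rewrite Qn q'Qn => /(_ isT).
have := n0e n n0n; have := psi_gt0 _ q'0 => p0 ne.
have : (1 - e) * psi q' <= (1 - n.+2%:R^-1) * psi q'.
  by rewrite ler_wpM2r ?(ltW p0)// lerD2l lerN2.
move=> H1 H2; have := le_lt_trans (le_trans H1 H2) xpq'.
by rewrite ltxx.
Qed.

(** In each coordinate the supremum of the left ends is common to the nested closed intervals. *)
Lemma nested_balls (z : nat -> 'rV[R]_d) (rho : nat -> R) :
  (forall n, 0 < rho n) ->
  (forall n, `|z n.+1 - z n| + rho n.+1 <= rho n) ->
  exists x, forall n, `|x - z n| <= rho n.
Proof.
move=> rho0 step.
have nest n m i : (n <= m)%N -> `|z m ord0 i - z n ord0 i| + rho m <= rho n.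
  move=> nm; rewrite -(subnKC nm); elim: (m - n)%N => [|k IH].
    by rewrite addn0 subrr normr0 add0r.
  rewrite addnS; have := step (n + k)%N.
  have := le_trans (rv_norm_coord (z (n + k).+1 - z (n + k)%N) i) (lexx _).
  rewrite rv_subE => H1 H2.
  have := ler_distD (z (n + k)%N ord0 i) (z (n + k).+1 ord0 i) (z n ord0 i).
  lra.
pose E i := [set y | exists n, y = z n ord0 i - rho n].
have ubE i n : ubound (E i) (z n ord0 i + rho n).
  move=> _ [m ->]; have [nm|/ltnW mn] := leqP n m.
    have := nest _ _ i nm; have := ler_norm (z m ord0 i - z n ord0 i).
    have := rho0 m; lra.
  have := nest _ _ i mn; have := ler_norm (z m ord0 i - z n ord0 i).
  rewrite distrC; have := rho0 n; lra.
exists (\row_i sup (E i)) => n; apply: rv_norm_le => [|i]; first exact: ltW.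
rewrite rv_subE mxE ler_distl; apply/andP; split.
  by apply: ub_le_sup; [exists (z 0%N ord0 i + rho 0%N); exact: ubE|exists n].
by apply: ge_sup; [exists (z 0%N ord0 i - rho 0%N), 0%N|exact: ubE].
Qed.

End exact_points.

(** * The divergence case *)

Section divergence.
Context {R : realType} (d : nat) (psi : nat -> R).
Context (d_ge1 : (1 <= d)%N)
  (psi_gt0 : forall q : nat, (1 <= q)%N -> 0 < psi q)
  (psi_nincr : forall q r : nat, (1 <= q)%N -> (q <= r)%N -> psi r <= psi q)
  (psi_sum : (\sum_(1 <= q <oo) (q%:R ^+ (3 * d) * psi q ^+ d)%:E < +oo)%E).
Context (s : R) (s_itv : 0 < s < d%:R).
Hypothesis divergence :
  (\sum_(1 <= q <oo) (q%:R ^+ d * psi q `^ s)%:E = +oo)%E.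

(** Starts the construction on the ball of radius [1 / 2] about the centre of the unit cube, using
    [q / 2 + 1 <= 2 * q ^ 3]. *)
Lemma initial_level : exists Q, forall N,
  \sum_(Q.+1 <= q < N) ((2^-1 * q%:R + 1) ^+ d * psi q ^+ d)
     <= vol_const d * 2^-1 ^+ d :> R.
Proof.
have e0 : 0 < vol_const d * 2^-1 ^+ d / 2 ^+ d :> R.
  by rewrite divr_gt0 ?exprn_gt0// mulr_gt0 ?vol_const_gt0// exprn_gt0 ?invr_gt0.
have [Q Q0 tail] := psi_tail psi_gt0 psi_sum e0.
exists Q => N; have := tail Q.+1 N (leqnSn Q).
rewrite ler_pdivlMr ?exprn_gt0// mulr_suml; apply: le_trans.
apply: ler_sum_nat => q /andP[Qq _].
have q0 : (0 < q)%N := leq_ltn_trans (leq0n _) Qq.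
have q1 : 1 <= (q%:R : R) by rewrite ler1n.
rewrite mulrAC ler_wpM2r ?exprn_ge0 ?(ltW (psi_gt0 q0))//.
have hL : 0 <= 2^-1 * q%:R + 1 :> R by lra.
have hR : 0 <= q%:R ^+ 3 * 2 :> R by rewrite mulr_ge0 ?exprn_ge0.
rewrite exprM -exprMn lerXn2r ?nnegrE//.
have : q%:R <= q%:R ^+ 3 :> R by rewrite exprS ler_peMr ?exprn_ege1//; lra.
lra.
Qed.

(** [light_child] is iterated with [eps = 1 / (n + 2)] on states made of a centre, a radius and a
    level; the point sought is the limit of the nested balls. *)
Lemma exact_point_avoiding (I : set nat) (a : nat -> 'rV[R]_d) (r : nat -> R) (M : R) :
  (forall i, I i -> 0 < r i) ->
  (forall U : seq nat, uniq U -> (forall i, i \in U -> I i) ->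
     \sum_(i <- U) r i `^ s <= M) ->
  (forall U : seq nat, uniq U -> (forall i, i \in U -> I i) ->
     \sum_(i <- U) r i ^+ d <= light_const d * 2^-1 ^+ d) ->
  exists2 x, Exact d psi x & forall i, I i -> r i <= `|a i - x|.
Proof.
move=> r_gt0 r_sum r_vol.
have /andP[s0 _] := s_itv.
have D1 : (1 < 2 ^ d)%N by rewrite -{1}(expn0 2) ltn_exp2l.
have div := divergent_condensation D1 (ltW s0) psi_gt0 psi_nincr divergence.
pose inv (st : 'rV[R]_d * R * nat) := [/\ 0 < st.1.2 <= 1,
  (forall N, \sum_(st.2.+1 <= q < N) ((st.1.2 * q%:R + 1) ^+ d * psi q ^+ d)
     <= vol_const d * st.1.2 ^+ d) & light I a r st.1.1 st.1.2].
pose next n (st st' : 'rV[R]_d * R * nat) := exists (p : 'rV[int]_d) q,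
  [/\ st'.1.2 <= st.1.2 / 2, `|st'.1.1 - st.1.1| + st'.1.2 <= st.1.2,
     (st.2 < q <= st'.2)%N & forall x, `|x - st'.1.1| <= st'.1.2 ->
     `|x - rpoint p q| < psi q /\ forall p' q', (st.2 < q' <= st'.2)%N ->
        (1 - n.+2%:R^-1) * psi q' <= `|x - rpoint p' q'|].
have exnext (nst : nat * {st | inv st}) :
    exists st' : {st | inv st}, next nst.1 (sval nst.2) (sval st').
  case: nst => n [[[x0 rho] Q] [/= rho01 vol li]].
  have eps01 : 0 < (n.+2%:R^-1 : R) <= 1 by rewrite invr_gt0 ltr0n invf_le1 ?ler1n.
  have [z [rho' [Q' [p [q [/andP[rho'0 rho'2] zx0 lz vol' [QqQ Hx]]]]]]] :=
    light_child d_ge1 psi_gt0 psi_nincr psi_sum s_itv r_gt0 r_sum rho01 eps01 vol li div.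
  have /andP[rho0 rho1] := rho01.
  have inv' : inv (z, rho', Q') by split=> //=; rewrite rho'0/=; lra.
  by exists (exist _ (z, rho', Q') inv'); exists p, q.
have [nx nxP] := choice exnext.
have [Q0 vol0] := initial_level.
have inv0 : inv (const_mx 2^-1, 2^-1, Q0).
  split=> //=; first by lra.
  by move=> U uU UI; apply: r_vol => // i /UI[].
pose st := fix st n : {st | inv st} :=
  if n is n'.+1 then nx (n', st n') else exist _ _ inv0.
have stP n : next n (sval (st n)) (sval (st n.+1)) := nxP (n, st n).
pose z n := (sval (st n)).1.1; pose rho n := (sval (st n)).1.2.
pose Q n := (sval (st n)).2.
have rho0 n : 0 < rho n by have [/andP[]] := svalP (st n).
have [|x xz] := @nested_balls R d z rho rho0.
  by move=> n; have [p [q []]] := stP n.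
have [f fP] := choice stP.
have [g gP] := choice fP.
exists x.
  apply: (@exact_of_levels R d psi x Q g f psi_gt0).
  - move=> i; have := le_trans (rv_norm_coord (x - z 0%N) i) (xz 0%N).
    by rewrite rv_subE mxE ler_norml => /andP[/=]; rewrite /rho/=; lra.
  - by move=> n; have [] := gP n.
  - by move=> n; have [_ _ _ H] := gP n; have [] := H x (xz n.+1).
  - by move=> n p' q'; have [_ _ _ H] := gP n; have [_] := H x (xz n.+1); apply.
move=> i Ii; rewrite leNgt; apply/negP => aix.
have ri0 := r_gt0 _ Ii.
(* A ball of the cover containing [x] meets every light ball of the sequence, so its radius is below
   all [rho n], which tend to 0. *)
have rrho n : r i <= rho n.
  have [_ _ li] := svalP (st n).
  have := li [:: i] isT; rewrite big_seq1 => H.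
  have {H} : r i ^+ d <= light_const d * rho n ^+ d.
    apply: H => j; rewrite inE => /eqP ->; split=> //.
    have := ler_distD x (a i) (z n); have := xz n; rewrite -/(z n) -/(rho n); lra.
  move=> H; rewrite -(@ler_pXn2r _ d)// ?nnegrE ?(ltW ri0) ?(ltW (rho0 n))//.
  apply: le_trans H _; rewrite ler_piMl ?exprn_ge0 ?(ltW (rho0 n))//.
  exact: light_const_le1.
have rho2 n : rho n <= (2 ^+ n)^-1.
  elim: n => [|n IH]; first by rewrite /rho/= expr0; lra.
  have [H _ _ _] := gP n; apply: (le_trans H).
  by rewrite exprS invfM mulrC ler_pM2l ?invr_gt0.
pose n := Num.truncn (r i)^-1.
have ri_ge0 : 0 <= (r i)^-1 by rewrite invr_ge0 ltW.
have /andP[_ nr] := truncn_itv ri_ge0.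
have : (2 ^+ n)^-1 < r i \/ (2 ^+ n.+1)^-1 < r i.
  right; rewrite -[ltRHS]invrK ltf_pV2 ?posrE ?invr_gt0 ?exprn_gt0//.
  by apply: lt_le_trans nr _; rewrite -natrX ler_nat ltnW// ltn_expl.
case.
- by rewrite ltNge (le_trans (rrho n) (rho2 n)).
- by rewrite ltNge (le_trans (rrho n.+1) (rho2 n.+1)).
Qed.

Lemma hausdorff_measure_Exact_infinite : hausdorff_measure s (Exact d psi) = +oo%E.
Proof.
have /andP[s0 sd] := s_itv.
apply/eqyP => M M0.
have V0 : 0 < light_const d * 2^-1 ^+ d :> R.
  by rewrite mulr_gt0 ?light_const_gt0// exprn_gt0 ?invr_gt0.
(* As [r ^ d <= r ^ s * delta ^ (d - s)], this [delta] turns the bound [M] on the sum of [r ^ s]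
   into the lightness of the initial ball. *)
pose delta := (light_const d * 2^-1 ^+ d / M) `^ (d%:R - s)^-1.
have delta0 : 0 < delta by rewrite powR_gt0// divr_gt0.
apply: ereal_sup_ge; exists (hausdorff_premeasure s delta (Exact d psi)).
  by exists delta.
apply: le_ereal_inf_tmp => _ [I [c [r [rI cov ->]]]].
rewrite leNgt; apply/negP => lM.
have r_gt0 i : I i -> 0 < r i by move=> /rI/andP[].
have r_sum (U : seq nat) : uniq U -> (forall i, i \in U -> I i) ->
    \sum_(i <- U) r i `^ s <= M.
  move=> uU UI; rewrite -lee_fin; apply: le_trans (ltW lM).
  apply: esum_ge; exists [set` U].
    by split; [exact: finite_seq|exact: UI].
  by rewrite -fsbig_seq// sumEFin.
have [|x xE xa] := @exact_point_avoiding I c r M r_gt0 r_sum.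
  move=> U uU UI; apply: (@le_trans _ _ (\sum_(i <- U) r i `^ s * delta `^ (d%:R - s))).
    rewrite big_seq [leRHS]big_seq; apply: ler_sum => i iU.
    have /andP[ri0 rid] := rI _ (UI _ iU).
    rewrite -powR_mulrn ?(ltW ri0)// -{1}[d%:R](subrK s) addrC powRD; last first.
      by rewrite (gt_eqF ri0) implybT.
    rewrite ler_wpM2l ?powR_ge0// ge0_ler_powR ?nnegrE ?(ltW ri0) ?(ltW delta0)//.
    by rewrite subr_ge0 ltW.
  rewrite -mulr_suml /delta -powRrM mulVf ?powRr1 ?gt_eqF ?subr_gt0//; last first.
    by rewrite divr_ge0 ?(ltW V0) ?(ltW M0).
  by rewrite mulrA ler_pdivrMr// mulrC ler_pM2l// r_sum.
have [i Ii] := cov x xE; rewrite -ball_normE /= => ix.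
by have := xa i Ii; rewrite leNgt ix.
Qed.

End divergence.

(** * The convergence case *)

Section convergence.
Context {R : realType} (d : nat) (psi : nat -> R).
Context (d_ge1 : (1 <= d)%N)
  (psi_gt0 : forall q : nat, (1 <= q)%N -> 0 < psi q)
  (psi_sum : (\sum_(1 <= q <oo) (q%:R ^+ (3 * d) * psi q ^+ d)%:E < +oo)%E).
Context (s : R) (s_itv : 0 < s < d%:R).
Hypothesis convergence :
  (\sum_(1 <= q <oo) (q%:R ^+ d * psi q `^ s)%:E < +oo)%E.

Lemma hausdorff_premeasure_Exact_le delta eta : 0 < delta -> 0 < eta ->
  (hausdorff_premeasure s delta (Exact d psi) <= eta%:E)%E.
Proof.
move=> delta0 eta0.
(* [psi q <= delta] makes the radii admissible; [psi q <= 1] keeps the relevant rationals within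
   [3 / 2] of the centre of the unit cube. *)
have d10 : 0 < Num.min delta 1 by rewrite lt_min delta0 ltr01.
have [Q1 Q10 psi3] := psi_cubic_decay d_ge1 psi_gt0 psi_sum d10.
have f0 q : (1 <= q)%N -> 0 <= q%:R ^+ d * psi q `^ s.
  by move=> _; rewrite mulr_ge0 ?exprn_ge0 ?powR_ge0.
have e0 : 0 < eta / 5 ^+ d by rewrite divr_gt0// exprn_gt0.
have [Q2 Q20 tail] :=
  bounded_series_tail f0 ((eseries_lt_pinftyP f0).1 convergence) e0.
pose Q := maxn Q1 Q2.
have Q_gt0 : (0 < Q)%N by rewrite leq_max Q10.
have psi_le q : (Q <= q)%N -> psi q <= Num.min delta 1.
  rewrite geq_max => /andP[Q1q _]; apply: le_trans (psi3 _ Q1q).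
  have q0 : (0 < q)%N := leq_trans Q10 Q1q.
  by rewrite ler_peMl ?(ltW (psi_gt0 q0))// exprn_ege1// ler1n.
have r32 : 0 <= 3 / 2 :> R by lra.
have ex_net q : exists net : seq 'rV[int]_d, (0 < q)%N ->
    (size net)%:R <= (2 * (3 / 2) * q%:R + 2) ^+ d :> R /\
    forall p : 'rV_d, `|rpoint p q - const_mx 2^-1| <= 3 / 2 :> R -> p \in net.
  have [q0|q0] := posnP q; first by exists [::]; rewrite q0.
  by have [net Hnet] := rational_net (const_mx 2^-1 : 'rV[R]_d) q0 r32; exists net.
have [net netP] := choice ex_net.
pose J := [set q | (Q <= q)%N] `*`` (fun q => `I_(size (net q))).
(* Covers are indexed by naturals, so the pairs of a denominator and a position in its net are
   encoded by [pickle]; the default is taken only off its image. *)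
pose ql i : nat * nat := odflt (0, 0)%N (unpickle i).
pose c i : 'rV[R]_d := rpoint (nth 0 (net (ql i).1) (ql i).2) (ql i).1.
apply: ge_ereal_inf; exists (\esum_(i in [set pickle x | x in J]) (psi (ql i).1 `^ s)%:E)%E.
  exists [set pickle x | x in J], c, (fun i => psi (ql i).1); split=> //.
    move=> _ [[q l] [/= Qq lq] <-]; rewrite /ql pickleK /=.
    rewrite psi_gt0 ?(leq_trans Q_gt0)//=.
    by have := psi_le _ Qq; rewrite le_min => /andP[].
  move=> x [[x01 inf] _].
  have [pq [apq Qpq]] : exists pq, approximants psi x pq /\ (Q <= pq.2)%N.
    apply: contrapT => /forallNP H; apply: inf.
    apply: (approximants_finite (Q := Q)) => pq apq.
    by rewrite leqNgt; apply/negP => /ltnW Qpq; apply: (H pq).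
  case: pq apq Qpq => p q [/= q0 xpq] Qq.
  have [_ /(_ p) inn] := netP q q0.
  have {inn} pnet : p \in net q.
    apply: inn; have xh : `|x - const_mx 2^-1| <= 2^-1.
      apply: rv_norm_le => [|i]; first by lra.
      by rewrite rv_subE mxE ler_norml; have /andP[? ?] := x01 i; lra.
    have := psi_le _ Qq; rewrite le_min => /andP[_ psi1].
    have := ler_distD x (rpoint p q) (const_mx 2^-1); rewrite (distrC _ x).
    rewrite -/(rpoint p q) in xpq; lra.
  exists (pickle (q, index p (net q))).
    by exists (q, index p (net q)) => //; split=> //=; rewrite index_mem.
  by rewrite /c /ql pickleK /= nth_index// -ball_normE /= distrC.
have bij : set_bij J [set pickle x | x in J] pickle.
  by apply: inj_bij => x y _ _; exact: (pcan_inj pickleK).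
rewrite (reindex_esum J _ _ _ bij).
rewrite (eq_esum (b := fun x => (psi x.1 `^ s)%:E)); last first.
  by move=> x _; rewrite /ql pickleK.
rewrite -(esum_esum (a := fun q _ => (psi q `^ s)%:E))//; last first.
  by move=> *; rewrite lee_fin powR_ge0.
rewrite (_ : [set q | (Q <= q)%N] = [set q | (fun q => (Q <= q)%N) q])//.
rewrite -(nneseries_esum (P := fun q => (Q <= q)%N)); last first.
  by move=> q _; apply: esum_ge0 => *; rewrite lee_fin powR_ge0.
apply: lime_le.
  apply: is_cvg_nneseries_cond => q _ _.
  by apply: esum_ge0 => *; rewrite lee_fin powR_ge0.
apply: nearW => N.
(* A net has at most [(3 * q + 2) ^ d <= (5 * q) ^ d] points. *)
apply: (@le_trans _ _ (\sum_(0 <= q < N | (Q <= q)%N)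
    (5 ^+ d * (q%:R ^+ d * psi q `^ s))%:E)%E).
  apply: lee_sum => q Qq; rewrite esum_fset//; last first.
  - by move=> *; rewrite lee_fin powR_ge0.
  - rewrite -fsbig_ord sumEFin lee_fin sumr_const card_ord -[leLHS]mulr_natl mulrA.
    rewrite ler_wpM2r ?powR_ge0//.
    have q0 : (0 < q)%N := leq_trans Q_gt0 Qq.
    have q1 : 1 <= (q%:R : R) by rewrite ler1n.
    have [nq _] := netP q q0; apply: le_trans nq _.
    rewrite -exprMn lerXn2r ?nnegrE ?mulr_ge0//; lra.
rewrite sumEFin lee_fin -mulr_sumr mulrC -ler_pdivlMr ?exprn_gt0//.
have [NQ|QN] := leqP N Q.
  rewrite big_nat_cond big1 ?(ltW e0)// => q /andP[/andP[_ qN] Qq].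
  by have := leq_trans (leq_trans qN NQ) Qq; rewrite ltnn.
rewrite (big_cat_nat (n := Q))/=; [|by []|exact: ltnW].
rewrite big_nat_cond big1 ?add0r; last first.
  by move=> q /andP[/andP[_ qQ] Qq]; have := leq_trans qQ Qq; rewrite ltnn.
rewrite big_nat_cond (eq_bigl (fun q => (Q <= q < N)%N && true)); last first.
  by move=> q; rewrite andbT; case: (Q <= q)%N; rewrite ?andbT ?andbF.
by rewrite -big_nat_cond; apply: tail; exact: leq_maxr.
Qed.

Lemma hausdorff_measure_Exact_0 : hausdorff_measure s (Exact d psi) = 0%E.
Proof.
apply/eqP; rewrite eq_le; apply/andP; split.
  apply: ge_ereal_sup => _ [delta /= delta0 <-].
  by apply/lee_addgt0Pr => e e0; rewrite add0e; exact: hausdorff_premeasure_Exact_le.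
apply: ereal_sup_ge; exists (hausdorff_premeasure s 1 (Exact d psi)).
  by exists 1 => //=.
apply: le_ereal_inf_tmp => _ [I [c [r [_ _ ->]]]].
by apply: esum_ge0 => i _; rewrite lee_fin powR_ge0.
Qed.

End convergence.

Theorem theorem3p2 (R : realType) (d : nat) (psi : nat -> R)
    (d_ge1 : (1 <= d)%N)
    (psi_gt0 : forall q : nat, (1 <= q)%N -> 0 < psi q)
    (psi_nincr : forall q r : nat, (1 <= q)%N -> (q <= r)%N -> psi r <= psi q)
    (psi_sum : (\sum_(1 <= q <oo) (q%:R ^+ (3 * d) * psi q ^+ d)%:E < +oo)%E)
    (s : R) (s_itv : 0 < s < d%:R) :
  ((\sum_(1 <= q <oo) (q%:R ^+ d * psi q `^ s)%:E < +oo)%E ->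
     hausdorff_measure s (Exact d psi) = 0%E) /\
  ((\sum_(1 <= q <oo) (q%:R ^+ d * psi q `^ s)%:E = +oo)%E ->
     hausdorff_measure s (Exact d psi) = +oo%E).
Proof.
split=> H.
- exact: (hausdorff_measure_Exact_0 d_ge1 psi_gt0 psi_sum).
- exact: (hausdorff_measure_Exact_infinite d_ge1 psi_gt0 psi_nincr psi_sum).
Qed.
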